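(* For every atomic flow $A$ there is an atomic flow $B$ such that $A\to_{\mathsf c}^\star B$ and every $\mathsf{ai}$-cycle in $B$ is a fragile cycle.
   Context: An atomic flow is a tuple $(V,E,\eta,up,lo)$: finite sets of vertices and edges, a labelling of vertices by interaction, cut, weakening, coweakening, contraction or cocontraction, and maps $up:E\to V\cup\{\top\}$, $lo:E\to V\cup\{\bot\}$. Upper edges of $\nu$: $lo(\epsilon)=\nu$; lower edges: $up(\epsilon)=\nu$. (Upper, lower) edge numbers: $(0,2)$ interaction, $(2,0)$ cut, $(0,1)$ weakening, $(1,0)$ coweakening, $(2,1)$ contraction, $(1,2)$ cocontraction; no directed cycles; there is $\pi:E\to\{+,-\}$ giving all edges of a (co)contraction the same sign and the two edges of an interaction/cut different signs. A path from $\nu$ to $\nu'$ is a sequence of edges $\epsilon_1,\dots,\epsilon_h$ with $lo(\epsilon_i)=up(\epsilon_{i+1})$, $up(\epsilon_1)=\nu$, $lo(\epsilon_h)=\nu'$; its reversal is a path from $\nu'$ to $\nu$. An $\mathsf{ai}$-path from $\nu$ to $\nu'$ is either a path from $\nu$ to $\nu'$ or a sequence $\epsilon_1,\dots,\epsilon_k,\epsilon_{k+1},\dots,\epsilon_h$ with $\epsilon_k\neq\epsilon_{k+1}$ such that, for some interaction or cut vertex $\nu''$, $\epsilon_1,\dots,\epsilon_k$ is an $\mathsf{ai}$-path from $\nu$ to $\nu''$ and $\epsilon_{k+1},\dots,\epsilon_h$ is an $\mathsf{ai}$-path from $\nu''$ to $\nu'$. An $\mathsf{ai}$-cycle is an $\mathsf{ai}$-path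 from a vertex to itself in which no edge appears twice. A simple edge is an edge whose upper endpoint is an interaction and whose lower endpoint is a cut. A fragile cycle is an $\mathsf{ai}$-cycle containing a simple edge. $\to_{\mathsf c}^\star$ is the reflexive-transitive closure of $\to_{\mathsf c}$, where $A\to_{\mathsf c}B$ means $B$ results from $A$ by one of these subgraph replacements: (c1) a contraction with upper edges $\epsilon_1,\epsilon_2$ whose lower edge is an upper edge of a cut with other upper edge $\epsilon_3$: replace by a new cocontraction with upper edge $\epsilon_3$ and new lower edges $\delta_1,\delta_2$, and two new cuts with upper edges $\{\epsilon_1,\delta_1\}$ and $\{\epsilon_2,\delta_2\}$; (c2) an interaction with lower edges $\epsilon_3,\epsilon_4$ where $\epsilon_4$ is the upper edge of a cocontraction with lower edges $\epsilon_1,\epsilon_2$: replace by a new contraction with lower edge $\epsilon_3$ and new upper edges $\delta_1,\delta_2$, and two new interactions with lower edges $\{\epsilon_1,\delta_1\}$ and $\{\epsilon_2,\delta_2\}$; (c3) a contraction with upper edges $\epsilon_1,\epsilon_2$ whose lower edge is the upper edge of a cocontraction with lower edges $\epsilon_3,\epsilon_4$: replace by cocontractions $\kappa_1,\kappa_2$ with upper edges $\epsilon_1,\epsilon_2$, contractions $\gamma_3,\gamma_4$ with lower edges $\epsilon_3,\epsilon_4$, and four new edges, one from each $\kappa_i$ to each $\gamma_j$. *)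

(* Defs.v *)
From mathcomp Require Import all_boot.
Set Implicit Arguments. Unset Strict Implicit. Unset Printing Implicit Defensive.

Inductive kind := Int | Cut | Wk | Cowk | Ctr | Coctr.

(* up e = None means up(e) = top ; lo e = None means lo(e) = bottom.
   Labels/endpoints are total functions on nat; only their values on
   fV / fE matter. *)
Record flow := Flow {
  fV : seq nat; fE : seq nat;
  lab : nat -> kind;
  up : nat -> option nat; lo : nat -> option nat }.

Definition upper (F : flow) (v : nat) := [seq e <- fE F | lo F e == Some v].
Definition lower (F : flow) (v : nat) := [seq e <- fE F | up F e == Some v].

Definition arity (k : kind) : nat * nat :=
  match k with
  | Int => (0, 2) | Cut => (2, 0) | Wk => (0, 1)
  | Cowk => (1, 0) | Ctr => (2, 1) | Coctr => (1, 2) end.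

Definition dpath (F : flow) (v v' : nat) (s : seq nat) : Prop :=
  match s with
  | [::] => False
  | e :: s' =>
      all (fun x => x \in fE F) s /\ up F e = Some v /\ lo F (last e s') = Some v' /\
      forall i, i.+1 < size s ->
        exists w, lo F (nth 0 s i) = Some w /\ up F (nth 0 s i.+1) = Some w
  end.

Definition endpoint_ok (F : flow) (o : option nat) :=
  match o with Some v => v \in fV F | None => true end.

Definition atomic_flow (F : flow) : Prop :=
  uniq (fV F) /\ uniq (fE F) /\
  (forall e, e \in fE F -> endpoint_ok F (up F e) /\ endpoint_ok F (lo F e)) /\
  (forall v, v \in fV F -> (size (upper F v), size (lower F v)) = arity (lab F v)) /\
  (forall v s, ~ dpath F v v s) /\
  exists pi : nat -> bool, forall v, v \in fV F ->
    match lab F v with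
    | Ctr | Coctr => forall e e', e \in upper F v ++ lower F v ->
                       e' \in upper F v ++ lower F v -> pi e = pi e'
    | Int | Cut => forall e e', e \in upper F v ++ lower F v ->
                       e' \in upper F v ++ lower F v -> e != e' -> pi e != pi e'
    | _ => True
    end.

Definition path (F : flow) (v v' : nat) (s : seq nat) : Prop :=
  dpath F v v' s \/ dpath F v' v (rev s).

Inductive aipath (F : flow) : nat -> nat -> seq nat -> Prop :=
| ai_base v v' s : path F v v' s -> aipath F v v' s
| ai_cat v w v' s1 s2 :
    w \in fV F -> (lab F w = Int \/ lab F w = Cut) ->
    s1 <> [::] -> s2 <> [::] -> last 0 s1 != head 0 s2 ->
    aipath F v w s1 -> aipath F w v' s2 -> aipath F v v' (s1 ++ s2).

Definition aicycle (F : flow) (v : nat) (s : seq nat) : Prop :=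
  v \in fV F /\ aipath F v v s /\ uniq s.

Definition simple_edge (F : flow) (e : nat) : Prop :=
  e \in fE F /\
  exists u w, up F e = Some u /\ lab F u = Int /\ lo F e = Some w /\ lab F w = Cut.

Definition fragile (F : flow) (v : nat) (s : seq nat) : Prop :=
  aicycle F v s /\ exists e, e \in s /\ simple_edge F e.

Definition c1_step (A B : flow) : Prop :=
  exists (g n e1 e2 e e3 k n1 n2 d1 d2 : nat),
  ((g \in fV A) /\ (lab A g = Ctr) /\ (n \in fV A) /\ (lab A n = Cut) /\ (((e1 \in fE A) /\ (e2 \in fE A) /\ (e1 != e2) /\ (lo A e1 = Some g) /\ (lo A e2 = Some g))) /\ (((e \in fE A) /\ (up A e = Some g) /\ (lo A e = Some n) /\ (e3 \in fE A) /\ (e3 != e) /\ (lo A e3 = Some n))) /\ (uniq [:: k, n1, n2 & fV A]) /\ (uniq [:: d1, d2 & fE A]) /\ (B = Flow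
        [:: k, n1, n2 & [seq x <- fV A | x \notin [:: g; n]]]
        [:: d1, d2 & [seq x <- fE A | x != e]]
        (fun x => if x == k then Coctr else if x == n1 then Cut
                  else if x == n2 then Cut else lab A x)
        (fun x => if x == d1 then Some k else if x == d2 then Some k else up A x)
        (fun x => if x == e3 then Some k else if x == e1 then Some n1
                  else if x == d1 then Some n1 else if x == e2 then Some n2
                  else if x == d2 then Some n2 else lo A x))).

Definition c2_step (A B : flow) : Prop :=
  exists (i k e1 e2 e3 e4 g i1 i2 d1 d2 : nat),
  ((i \in fV A) /\ (lab A i = Int) /\ (k \in fV A) /\ (lab A k = Coctr) /\ (((e3 \in fE A) /\ (e4 \in fE A) /\ (e3 != e4) /\ (up A e3 = Some i) /\ (up A e4 = Some i))) /\ (((lo A e4 = Some k) /\ (e1 \in fE A) /\ (e2 \in fE A) /\ (e1 != e2) /\ (up A e1 = Some k) /\ (up A e2 = Some k))) /\ (uniq [:: g, i1, i2 & fV A]) /\ (uniq [:: d1, d2 & fE A]) /\ (B = Flow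
        [:: g, i1, i2 & [seq x <- fV A | x \notin [:: i; k]]]
        [:: d1, d2 & [seq x <- fE A | x != e4]]
        (fun x => if x == g then Ctr else if x == i1 then Int
                  else if x == i2 then Int else lab A x)
        (fun x => if x == e3 then Some g else if x == e1 then Some i1
                  else if x == d1 then Some i1 else if x == e2 then Some i2
                  else if x == d2 then Some i2 else up A x)
        (fun x => if x == d1 then Some g else if x == d2 then Some g else lo A x))).

Definition c3_step (A B : flow) : Prop :=
  exists (g k e1 e2 e e3 e4 k1 k2 g3 g4 d13 d14 d23 d24 : nat),
  ((g \in fV A) /\ (lab A g = Ctr) /\ (k \in fV A) /\ (lab A k = Coctr) /\ (((e1 \in fE A) /\ (e2 \in fE A) /\ (e1 != e2) /\ (lo A e1 = Some g) /\ (lo A e2 = Some g))) /\ (((e \in fE A) /\ (up A e = Some g) /\ (lo A e = Some k) /\ (e3 \in fE A) /\ (e4 \in fE A) /\ (e3 != e4) /\ (up A e3 = Some k /\ up A e4 = Some k))) /\ (uniq [:: k1, k2, g3, g4 & fV A]) /\ (uniq [:: d13, d14, d23, d24 & fE A]) /\ (B = Flow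
        [:: k1, k2, g3, g4 & [seq x <- fV A | x \notin [:: g; k]]]
        [:: d13, d14, d23, d24 & [seq x <- fE A | x != e]]
        (fun x => if x == k1 then Coctr else if x == k2 then Coctr
                  else if x == g3 then Ctr else if x == g4 then Ctr else lab A x)
        (fun x => if x == e3 then Some g3 else if x == e4 then Some g4
                  else if x == d13 then Some k1 else if x == d14 then Some k1
                  else if x == d23 then Some k2 else if x == d24 then Some k2
                  else up A x)
        (fun x => if x == e1 then Some k1 else if x == e2 then Some k2
                  else if x == d13 then Some g3 else if x == d23 then Some g3
                  else if x == d14 then Some g4 else if x == d24 then Some g4
                  else lo A x))).

Definition c_step (A B : flow) : Prop := c1_step A B \/ c2_step A B \/ c3_step A B.

Inductive c_star : flow -> flow -> Prop :=
| cs_refl A : c_star A A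
| cs_step A B C : c_step A B -> c_star B C -> c_star A C.

(* Main.v *)
(* Fix a sign [pi] of the edges and traverse positive edges downwards and
   negative ones upwards: ai-cycles become directed cycles, contractions on
   positive edges become merges and cocontractions on positive edges become
   splits, while interactions and cuts are passed straight through.  First push
   the positive contractions down through positive cocontractions (c3) and
   through cuts (c1), where they turn into negative cocontractions; then push
   the positive cocontractions up through interactions (c2), where they turn
   into negative contractions.  In the result a positive edge leaving a
   contraction never meets a cut or a cocontraction, and one leaving an
   interaction never meets a cocontraction.  By acyclicity an ai-cycle has a
   topmost positive edge, which leaves an interaction; it cannot enter a
   contraction, below which only contractions could follow forever, so it
   enters a cut.

   The first phase terminates because every positive edge [e] carries a weight
   [c e] that dominates the weights of the edges below it, with a surplus of 2
   at cocontractions: the sum of [c e + 1] over the positive edges [e] leaving a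
   contraction decreases.  In the second phase the number of positive
   cocontractions decreases. *)

From HB Require Import structures.
Require Import Defs.
From mathcomp Require Import all_boot zify.
Set Implicit Arguments. Unset Strict Implicit. Unset Printing Implicit Defensive.

(** * Signed flows, with acyclicity kept apart as a rank *)

Definition kind_code (k : kind) : nat :=
  match k with Int => 0 | Cut => 1 | Wk => 2 | Cowk => 3 | Ctr => 4 | Coctr => 5 end.
Definition kind_decode (n : nat) : kind :=
  nth Int [:: Int; Cut; Wk; Cowk; Ctr; Coctr] n.
Lemma kind_codeK : cancel kind_code kind_decode. Proof. by case. Qed.
HB.instance Definition _ := Equality.copy kind (can_type kind_codeK).

Definition signs (pi : nat -> bool) (k : kind) (s : seq nat) : Prop :=
  match k with
  | Ctr | Coctr => forall e e', e \in s -> e' \in s -> pi e = pi e'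
  | Int | Cut => forall e e', e \in s -> e' \in s -> e != e' -> pi e != pi e'
  | _ => True
  end.

(** Takes a label and two edge lists instead of a vertex, so that it can be carried along
    permutations of the lists and along duality. *)
Definition local_ok (pi : nat -> bool) (k : kind) (us ls : seq nat) : Prop :=
  (size us, size ls) = arity k /\ signs pi k (us ++ ls).

(* [atomic_flow] without acyclicity, which [ranked] expresses instead. *)
Record preflow (F : flow) (pi : nat -> bool) : Prop := Preflow {
  pf_uniqV : uniq (fV F);
  pf_uniqE : uniq (fE F);
  pf_ends : forall e, e \in fE F -> endpoint_ok F (up F e) /\ endpoint_ok F (lo F e);
  pf_local : forall v, v \in fV F -> local_ok pi (lab F v) (upper F v) (lower F v) }.

(** A numerical certificate of acyclicity, which a local rewrite can update vertex by vertex. *)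
Definition ranked (F : flow) (h : nat -> nat) : Prop :=
  forall e u w, e \in fE F -> up F e = Some u -> lo F e = Some w -> h w < h u.

Definition kup (F : flow) e := omap (lab F) (up F e).
Definition klo (F : flow) e := omap (lab F) (lo F e).

Lemma mem_upper F v e : (e \in upper F v) = (e \in fE F) && (lo F e == Some v).
Proof. by rewrite mem_filter andbC. Qed.

Lemma mem_lower F v e : (e \in lower F v) = (e \in fE F) && (up F e == Some v).
Proof. by rewrite mem_filter andbC. Qed.

Lemma preflow_up F pi e v : preflow F pi -> e \in fE F -> up F e = Some v -> v \in fV F.
Proof. by move=> pf /(pf_ends pf)[+ _] => /[swap] ->. Qed.

Lemma preflow_lo F pi e v : preflow F pi -> e \in fE F -> lo F e = Some v -> v \in fV F.
Proof. by move=> pf /(pf_ends pf)[_ +] => /[swap] ->. Qed.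

(** * Ai-paths as directed walks *)

Section AiPaths.
Variables (F : flow) (pi : nat -> bool) (h : nat -> nat).
Hypotheses (pf : preflow F pi) (rk : ranked F h).

Lemma arityP v : v \in fV F ->
  size (upper F v) = (arity (lab F v)).1 /\ size (lower F v) = (arity (lab F v)).2.
Proof. by move=> /(pf_local pf)[<-]. Qed.

Lemma signs_at v e e' : v \in fV F -> e \in upper F v ++ lower F v ->
  e' \in upper F v ++ lower F v ->
  match lab F v with
  | Ctr | Coctr => pi e = pi e' | Int | Cut => e != e' -> pi e != pi e' | _ => True end.
Proof.
by move=> /(pf_local pf)[_]; case: (lab F v) => //= + ie ie'; apply.
Qed.

(* [b] is the direction of traversal: [false] goes down the positive edges and
   up the negative ones, [true] does the opposite. *)
Definition etail (b : bool) e := if pi e (+) b then up F e else lo F e.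
Definition ehead (b : bool) e := if pi e (+) b then lo F e else up F e.
(** The second conjunct keeps two open ends, at the top or bottom of the flow, from matching as
    [None]. *)
Definition follows b e e' := (ehead b e == etail b e') && (etail b e' != None).

Definition walk b v v' s :=
  [/\ s != [::], {subset s <= fE F}, etail b (head 0 s) = Some v,
      ehead b (last 0 s) = Some v' & sorted (follows b) s].

Definition below e e' := (lo F e == up F e') && (up F e' != None).

(** The vertex between the two edges has both an upper and a lower edge, so by arity it is a
    contraction or a cocontraction. *)
Lemma below_sign e e' : e \in fE F -> e' \in fE F -> below e e' -> pi e = pi e'.
Proof.
move=> eE e'E /andP[/eqP]; case u: (up F e') => [w|//] l _.
have wV := preflow_up pf e'E u.
have ew : e \in upper F w by rewrite mem_upper eE l eqxx.
have e'w : e' \in lower F w by rewrite mem_lower e'E u eqxx.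
have := @signs_at w e e' wV; rewrite !mem_cat ew e'w orbT => /(_ isT isT).
have [] := arityP wV; move: ew e'w.
by case: (upper F w); case: (lower F w) => //=; case: (lab F w).
Qed.

Lemma below_signs s : {subset s <= fE F} -> sorted below s ->
  {in s, forall e, pi e = pi (head 0 s)}.
Proof.
case: s => // e s; elim: s e => [|e' s IH] e sE /=; first by move=> _ x; rewrite inE => /eqP->.
case/andP=> b p x; rewrite inE => /orP[/eqP->//|xs].
have se : {subset e' :: s <= fE F} by move=> y ys; apply: sE; rewrite inE ys orbT.
rewrite (IH e') //=; apply/esym/below_sign => //; first by apply: sE; rewrite inE eqxx.
by apply: se; rewrite inE eqxx.
Qed.

Lemma dpath_below v v' s : dpath F v v' s ->
  [/\ s != [::], {subset s <= fE F}, up F (head 0 s) = Some v,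
      lo F (last 0 s) = Some v' & sorted below s].
Proof.
case: s => // e s [/allP sE [u [l c]]]; split=> //=.
apply/(pathP 0) => i lt; have [|w [l' u']] := c i; first by rewrite ltnS.
by rewrite /below l' u' eqxx.
Qed.

Lemma mem_head0 s : s != [::] -> head 0 s \in s.
Proof. by case: s => //= e s _; rewrite inE eqxx. Qed.

Lemma mem_last0 s : s != [::] -> last 0 s \in s.
Proof. by case: s => //= e s _; rewrite mem_last. Qed.

(** A descending path has constant sign, so a single direction [b] goes down all of its edges. *)
Lemma dpath_walk v v' s : dpath F v v' s -> exists b, walk b v v' s.
Proof.
move=> /dpath_below[s0 sE hs ls so].
have sg := below_signs sE so.
exists (~~ pi (head 0 s)).
have ud e : e \in s -> pi e (+) ~~ pi (head 0 s) by move=> /sg ->; rewrite addbN addbb.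
split=> //; rewrite ?/etail ?/ehead ?ud ?mem_head0 ?mem_last0 //.
apply: (sub_in_sorted (P := mem s) _ _ so) => [x y /= xs ys|]; last exact/allP.
by rewrite /follows /etail /ehead !ud.
Qed.

Lemma rev_dpath_walk v v' s : dpath F v' v (rev s) -> exists b, walk b v v' s.
Proof.
move=> /dpath_below[s0 sE hs ls so].
have sg := below_signs sE so.
have {}s0 : s != [::] by rewrite -size_eq0 -size_rev size_eq0.
have {}hs : up F (last 0 s) = Some v'.
  by case/lastP: (s) hs s0 => //= s' e; rewrite rev_rcons last_rcons.
have {}ls : lo F (head 0 s) = Some v.
  by case: (s) ls s0 => //= e s'; rewrite rev_cons last_rcons.
exists (pi (head 0 (rev s))).
have ud e : e \in s -> pi e (+) pi (head 0 (rev s)) = false.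
  by move=> es; rewrite sg ?mem_rev ?addbb.
split=> //; rewrite ?/etail ?/ehead ?ud ?mem_head0 ?mem_last0 //.
  by move=> x xs; apply: sE; rewrite mem_rev.
rewrite rev_sorted in so.
apply: (sub_in_sorted (P := mem s) _ _ so) => [x y /= xs ys|]; last exact/allP.
rewrite /follows /etail /ehead !ud //.
by case/andP=> /eqP ->; rewrite eqxx.
Qed.

(** At the turning vertex both the sign and the vertical sense of travel are reversed, and the two
    reversals cancel: the pieces have the same direction. *)
Lemma aipath_walk v v' s : aipath F v v' s -> exists b, walk b v v' s.
Proof.
elim=> {v v' s} [v v' s [/dpath_walk|/rev_dpath_walk] //|v w v' s1 s2 wV kw].
move=> /eqP s10 /eqP s20 ne _ [b [_ sE1 h1 l1 so1]] _ [b' [_ sE2 h2 l2 so2]].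
have eE := sE1 _ (mem_last0 s10); have e'E := sE2 _ (mem_head0 s20).
have bb : b' = b.
  have inc e : e \in fE F -> up F e = Some w \/ lo F e = Some w ->
      e \in upper F w ++ lower F w.
    by rewrite mem_cat mem_upper mem_lower => -> [] ->; rewrite eqxx ?orbT.
  have i1 : last 0 s1 \in upper F w ++ lower F w.
    by apply: inc => //; move: l1; rewrite /ehead; case: ifP; auto.
  have i2 : head 0 s2 \in upper F w ++ lower F w.
    by apply: inc => //; move: h2; rewrite /etail; case: ifP; auto.
  have sg : pi (last 0 s1) != pi (head 0 s2).
    by have := signs_at wV i1 i2; case: kw => ->; apply.
  have [su sl] := arityP wV.
  (* An interaction has no upper edge and a cut no lower one. If [b] and [b'] differed, the opposite
     signs would make one of the two edges enter [w] and the other leave it. *)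
  have nud e e' : e \in fE F -> e' \in fE F -> up F e = Some w -> lo F e' = Some w -> False.
    move=> ie ie' u l.
    have : e \in lower F w by rewrite mem_lower ie u eqxx.
    have : e' \in upper F w by rewrite mem_upper ie' l eqxx.
    by move: su sl; case: kw => ->; case: (upper F w); case: (lower F w).
  move: sg l1 h2; rewrite /ehead /etail.
  case: (pi (last 0 s1)); case: (pi (head 0 s2)); case: b {so1 h1}; case: b' {so2 l2} => //= _ p q;
  by [case: (nud _ _ _ _ p q) | case: (nud _ _ _ _ q p)].
rewrite {b'}bb in h2 l2 so2; exists b.
case: s1 s2 s10 s20 {ne} sE1 sE2 h1 h2 l1 l2 so1 so2 {eE e'E} => // e s1 [] // e' s2 _ _.
move=> /= sE1 sE2 h1 h2 l1 l2 so1 so2; split=> //=.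
- by move=> x; rewrite -cat_cons mem_cat => /orP[/sE1|/sE2].
- by rewrite last_cat.
by rewrite cat_path so1 /= so2 andbT /follows l1 h2 eqxx.
Qed.

Lemma aicycle_walk v s : aicycle F v s ->
  exists b, [/\ s != [::], {subset s <= fE F} & cycle (follows b) s].
Proof.
move=> [_ [/aipath_walk[b [s0 sE hs l so]] _]]; exists b; split=> //.
case: s s0 {sE} hs l so => //= e s _ hs l so.
by rewrite rcons_path so /follows /= l hs eqxx.
Qed.

(** From here on a cycle is only a set of edges in which each has a successor and a predecessor.
    This is symmetric under reversal, so direction [true] reduces to [false] by exchanging the
    two. *)
Lemma aicycle_closed v s : aicycle F v s ->
  [/\ s != [::], {subset s <= fE F},
    {in s, forall e, exists2 e', e' \in s & follows false e e'} &
    {in s, forall e, exists2 e', e' \in s & follows false e' e}].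
Proof.
move=> /aicycle_walk[b [s0 sE cy]].
have nx : {in s, forall e, exists2 e', e' \in s & follows b e e'}.
  by move=> e es; exists (next s e); rewrite ?mem_next // next_cycle.
have pv : {in s, forall e, exists2 e', e' \in s & follows b e' e}.
  by move=> e es; exists (prev s e); rewrite ?mem_prev // prev_cycle.
case: b cy nx pv => _ nx pv; last by split.
have sw e e' : follows true e e' -> follows false e' e.
  rewrite /follows /ehead /etail !addbT !addbF.
  by case: (pi e); case: (pi e') => /= /andP[/eqP ->]; rewrite eqxx.
split=> // e es; first by have [e' e's f] := pv _ es; exists e'; last exact: sw.
by have [e' e's f] := nx _ es; exists e'; last exact: sw.
Qed.

(** * Normal forms of the two phases, and simple edges in closed sets of edges *)

Definition no_ctr_redex := forall e, e \in fE F -> pi e -> kup F e = Some Ctr ->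
  klo F e <> Some Cut /\ klo F e <> Some Coctr.
(** Both conditions concern positive edges alone: redexes on negative edges may survive, and the
    second phase itself creates negative contractions. *)
Definition no_int_redex := forall e, e \in fE F -> pi e -> kup F e = Some Int ->
  klo F e <> Some Coctr.

Lemma no_descent (s : seq nat) (P : pred nat) (f : nat -> nat) :
  (forall e, e \in s -> P e -> exists e', [/\ e' \in s, P e' & f e' < f e]) ->
  {in s, forall e, ~ P e}.
Proof.
move=> st e; have [n] := ubnP (f e); elim: n e => // n IH e lt es Pe.
by have [e' [e's Pe' lt']] := st e es Pe; apply: (IH e') => //; apply: leq_trans lt' lt.
Qed.

(** On the finite list [s] the distance of [f] to its maximum descends. *)
Lemma no_ascent (s : seq nat) (P : pred nat) (f : nat -> nat) :
  (forall e, e \in s -> P e -> exists e', [/\ e' \in s, P e' & f e < f e']) ->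
  {in s, forall e, ~ P e}.
Proof.
move=> st; apply: (no_descent (f := fun e => \max_(x <- s) f x - f e)) => e es Pe.
have [e' [e's Pe' lt]] := st e es Pe; exists e'; split=> //.
by apply: ltn_sub2l => //; exact: leq_trans lt (leq_bigmax_seq e' e's isT).
Qed.

Lemma mem_size1 (s : seq nat) x y : x \in s -> y \in s -> size s <= 1 -> x = y.
Proof. by case: s => [|a [|b s]] //; rewrite !inE => /eqP-> /eqP->. Qed.

Lemma closed_simple (s : seq nat) : no_ctr_redex -> no_int_redex ->
  s != [::] -> {subset s <= fE F} ->
  {in s, forall e, exists2 e', e' \in s & follows false e e'} ->
  {in s, forall e, exists2 e', e' \in s & follows false e' e} ->
  exists e, e \in s /\ simple_edge F e.
Proof.
move=> nr1 nr2 s0 sE nx pv.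
(* Edges are compared by the rank of their upper endpoint. Every edge of [s] has one, since it has
   both a successor and a predecessor, so the default 0 is not reached on [s]. *)
pose hU e := if up F e is Some u then h u else 0.
have hU_lt e e' w : e \in s -> lo F e = Some w -> up F e' = Some w -> hU e' < hU e.
  move=> es l u'; rewrite /hU u'.
  have: up F e != None.
    have [e2 _ /andP[_]] := pv e es; have [e3 _ /andP[/eqP]] := nx e es.
    by rewrite /ehead /etail !addbF; case: (pi e) => [//|->].
  by case u: (up F e) => [u1|//] _; apply: (rk (sE _ es) u l).
(* Only cuts and contractions have two upper edges, and those of a contraction have equal signs. The
   same count of lower edges singles out interactions in [lower_sign]. *)
have upper_sign e e' w : e \in s -> e' \in s -> lo F e = Some w -> lo F e' = Some w ->
    pi e -> ~~ pi e' -> lab F w = Cut.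
  move=> es e's u u' p np; have wV := preflow_lo pf (sE _ es) u.
  have i1 : e \in upper F w by rewrite mem_upper sE // u eqxx.
  have i2 : e' \in upper F w by rewrite mem_upper sE // u' eqxx.
  have := @signs_at w e e' wV; rewrite !mem_cat i1 i2 => /(_ isT isT).
  have [] := arityP wV; rewrite p (negbTE np) {u u'}.
  have ne : e != e' by apply: contraNneq np => <-.
  have := mem_size1 i1 i2.
  by case: (lab F w) => //= one su _ _; rewrite one ?su ?eqxx in ne.
have lower_sign e e' w : e \in s -> e' \in s -> up F e = Some w -> up F e' = Some w ->
    pi e -> ~~ pi e' -> lab F w = Int.
  move=> es e's u u' p np; have wV := preflow_up pf (sE _ es) u.
  have i1 : e \in lower F w by rewrite mem_lower sE // u eqxx.
  have i2 : e' \in lower F w by rewrite mem_lower sE // u' eqxx.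
  have := @signs_at w e e' wV; rewrite !mem_cat i1 i2 !orbT => /(_ isT isT).
  have [] := arityP wV; rewrite p (negbTE np) {u u'}.
  have ne : e != e' by apply: contraNneq np => <-.
  have := mem_size1 i1 i2.
  by case: (lab F w) => //= one _ sl _; rewrite one ?sl ?eqxx in ne.
(* Otherwise the successors, all negative, would climb forever. *)
have [p ps pp] : exists2 p, p \in s & pi p.
  apply/hasP/negPn/negP => /hasPn neg.
  have [] := no_ascent (P := predT) (f := hU) (s := s) _ (mem_head0 s0) isT.
  move=> e es _; have [e' e's] := nx e es; rewrite /follows /ehead /etail !addbF.
  rewrite (negbTE (neg e es)) (negbTE (neg e' e's)) => /andP[/eqP ue].
  case l: (lo F e') ue => [w|//] ue _; exists e'; split=> //.
  exact: hU_lt l ue.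
(* The predecessor of a positive edge is either positive and strictly higher, or negative and leaves
   the same vertex, which is then an interaction. The first case cannot recur forever. *)
have [i [is_ pi_i ki]] : exists i, [/\ i \in s, pi i & kup F i = Some Int].
  have [/hasP[i is_ /andP[pi_i /eqP ki]]|/hasPn none] :=
    boolP (has (fun i => pi i && (kup F i == Some Int)) s); first by exists i.
  have [] := no_ascent (P := pi) (f := hU) _ ps pp => e es pe.
  have [e' e's] := pv e es; rewrite /follows /ehead /etail !addbF pe.
  case/andP=> /eqP + un; case u: (up F e) un => [w|//] _.
  case: (boolP (pi e')) => pe' he'; first by exists e'; split=> //; apply: hU_lt he' u.
  by have := none _ es; rewrite pe /kup u /= (lower_sign e e' w).
(* A negative successor means that [e] enters a cut. A positive one leaves the vertex that [e]
   enters, which is therefore a contraction or a cocontraction. *)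
have down e : e \in s -> pi e -> klo F e = Some Cut \/ klo F e = Some Coctr \/
   klo F e = Some Ctr /\ exists e', [/\ e' \in s, pi e' && (kup F e' == Some Ctr) & hU e' < hU e].
  move=> es pe; have [e' e's] := nx e es; rewrite /follows /ehead /etail !addbF pe.
  case l: (lo F e) => [w|]; last by case/andP=> /eqP <-.
  rewrite /klo l /=; case/andP=> /eqP; case: (boolP (pi e')) => pe' /esym ue' _; last first.
    by left; rewrite (upper_sign e e' w).
  have wV := preflow_lo pf (sE _ es) l.
  have i1 : e \in upper F w by rewrite mem_upper sE // l eqxx.
  have i2 : e' \in lower F w by rewrite mem_lower sE // ue' eqxx.
  have := hU_lt _ _ _ es l ue'; have [] := arityP wV; move: i1 i2.
  case: (upper F w); case: (lower F w) => // a l1 b l2 _ _; case k: (lab F w) => //; auto.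
  by right; right; split=> //; exists e'; split; rewrite // pe' /kup ue' /= k.
have [cut|[co|[_ [c [cs Pc _]]]]] := down i is_ pi_i; last 2 first.
- by case: (nr2 i (sE _ is_) pi_i ki co).
(* Below a positive edge leaving a contraction, [no_ctr_redex] allows only another contraction, so
   the descent would not end. *)
- have [] := no_descent (f := hU) (P := fun e => pi e && (kup F e == Some Ctr)) _ cs Pc.
  move=> e es /andP[pe /eqP ke]; have [n1 n2] := nr1 e (sE _ es) pe ke.
  by have [|[|[]]] := down e es pe.
exists i; split=> //; split; first exact: sE.
move: ki cut; rewrite /kup /klo; case: (up F i) (lo F i) => [u|] [w|] //= [ku] [kw].
by exists u, w.
Qed.

End AiPaths.

(** * Acyclicity and ranks *)

Lemma ranked_dpath F h v v' s : ranked F h -> dpath F v v' s -> h v' < h v.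
Proof.
move=> rk /dpath_below[]; case: s => // e s _ /=.
elim: s e v => [|e' s IH] e v sE u l /=; first by move=> _; apply: rk u l; apply: sE; rewrite inE.
have eE : e \in fE F by apply: sE; rewrite inE eqxx.
case/andP=> /andP[/eqP le]; case u': (up F e') le => [w|//] le _ so.
by apply: ltn_trans (IH e' w _ u' l so) (rk _ _ _ eE u le) => x xs; apply: sE; rewrite inE xs orbT.
Qed.

Lemma dpath_cons F e v w v' s : e \in fE F -> up F e = Some v -> lo F e = Some w ->
  dpath F w v' s -> dpath F v v' (e :: s).
Proof.
case: s => // e' s eE u l [sE [u' [l' c]]]; split; first by rewrite /= eE.
by do 2!split=> //; case=> [|i] lt; [exists w | apply: (c i)].
Qed.

(** The rank of a vertex is the number of vertices reachable from it downwards. Along an edge from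
    [x] to [y] the reachable set shrinks strictly: it loses [x], since a path from [y] back to [x]
    would close a directed cycle. *)
Lemma acyclic_ranked F : (forall e, e \in fE F -> endpoint_ok F (up F e) /\ endpoint_ok F (lo F e)) ->
  (forall v s, ~ dpath F v v s) -> exists h, ranked F h.
Proof.
move=> ends acyc.
pose r (x y : seq_sub (fV F)) :=
  has (fun e => (up F e == Some (val x)) && (lo F e == Some (val y))) (fE F).
have r_dpath x y p : r x y -> path.path r y p -> exists s, dpath F (val x) (val (last y p)) s.
  elim: p x y => [|z p IH] x y /= /hasP[e eE /andP[/eqP u /eqP l]].
    by move=> _; exists [:: e]; split; rewrite /= ?eE //; split=> //; split=> // -[].
  by case/andP=> ryz /(IH y z ryz)[s d]; exists (e :: s); apply: dpath_cons d.
exists (fun v => if insub v is Some x then #|connect r x| else 0) => e u w eE ue le.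
have [] := ends e eE; rewrite ue le /= => uV wV.
rewrite !insubT /=; set x := Sub u uV; set y := Sub w wV.
have rxy : r x y by apply/hasP; exists e; rewrite // ue le !SubK !eqxx.
apply/proper_card/properP; split.
  by apply/subsetP => z; apply: connect_trans (connect1 rxy).
exists x; first exact: connect0.
apply/negP => /connectP[p py ex]; have [s] := r_dpath x y p rxy py.
by rewrite -ex; apply: acyc.
Qed.

Lemma atomic_flow_ranked F : atomic_flow F -> exists pi h, preflow F pi /\ ranked F h.
Proof.
move=> [uV [uE [ends [ar [ac [pi sg]]]]]]; have [h rk] := acyclic_ranked ends ac.
exists pi, h; split=> //; split=> // v vV; split; first exact: ar.
exact: sg.
Qed.

Lemma ranked_atomic_flow F pi h : preflow F pi -> ranked F h -> atomic_flow F.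
Proof.
move=> [uV uE ends loc] rk; do 3!split=> //.
split; first by move=> v /loc[].
split; first by move=> v s /(ranked_dpath rk); rewrite ltnn.
by exists pi => v /loc[].
Qed.

(** * Local effect of the reduction steps *)

Lemma mem_neq (s : seq nat) a b : a \in s -> b \notin s -> a != b.
Proof. by move=> sa; apply: contraNneq => <-. Qed.

Lemma eq_Some (T : eqType) (a b : T) : (Some a == Some b) = (a == b).
Proof. by []. Qed.

(** Once the arity is known, exhibiting that many distinct edges exhibits all of them. *)
Lemma upper_perm F v l : uniq (fE F) -> uniq l -> {subset l <= upper F v} ->
  size (upper F v) = size l -> perm_eq (upper F v) l.
Proof.
move=> uE ul sub sz; rewrite perm_sym uniq_perm ?filter_uniq //.
by have [] := uniq_min_size ul sub; rewrite ?sz.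
Qed.

Lemma lower_perm F v l : uniq (fE F) -> uniq l -> {subset l <= lower F v} ->
  size (lower F v) = size l -> perm_eq (lower F v) l.
Proof.
move=> uE ul sub sz; rewrite perm_sym uniq_perm ?filter_uniq //.
by have [] := uniq_min_size ul sub; rewrite ?sz.
Qed.

Definition has_star F v k us ls :=
  [/\ lab F v = k, perm_eq (upper F v) us & perm_eq (lower F v) ls].

(** Equality of lists, not just up to permutation as in [has_star]: the steps keep the surviving
    edges in their order. *)
Definition same_star A B v :=
  [/\ lab B v = lab A v, upper B v = upper A v & lower B v = lower A v].

Lemma signs_perm pi pi' k s s' : {in s', pi =1 pi'} -> s =i s' ->
  signs pi k s -> signs pi' k s'.
Proof.
by move=> ep es; case: k => //= sg e e' ie ie'; rewrite -!ep // => *; apply: sg; rewrite ?es.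
Qed.

Lemma local_ok_perm pi pi' k us us' ls ls' : {in us' ++ ls', pi =1 pi'} ->
  perm_eq us us' -> perm_eq ls ls' -> local_ok pi k us ls -> local_ok pi' k us' ls'.
Proof.
move=> ep pu pl [ar sg]; split; first by rewrite -(perm_size pu) -(perm_size pl).
by apply: signs_perm sg => // x; rewrite !mem_cat (perm_mem pu) (perm_mem pl).
Qed.

Ltac neq :=
  first [ assumption | rewrite eq_sym; assumption
        | match goal with
          | H : is_true (?a \in ?S), H' : is_true (?b \notin ?S) |- is_true (?a != ?b) => exact (mem_neq H H')
          | H : is_true (?b \in ?S), H' : is_true (?a \notin ?S) |- is_true (?a != ?b) =>
             rewrite eq_sym; exact (mem_neq H H')
          end].

(** Evaluates the nested equality tests of the rewritten maps, separating old names from fresh ones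
    by membership. *)
Ltac eqs :=
  rewrite ?eq_Some ?eqxx ?andbT ?andbF ?orbT ?orbF /=;
  repeat (match goal with
    | |- context [@eq_op _ ?a ?b] => rewrite (negbTE (_ : a != b)); [|solve [neq]]
    | H : is_true (?a \in ?S) |- context [?a \in ?S] => rewrite H
    | H : is_true (?a \notin ?S) |- context [?a \in ?S] => rewrite (negbTE H)
    | H : ?f ?A ?x = Some ?v |- context [?f ?A ?x] => rewrite H
    end; rewrite ?eq_Some ?eqxx ?andbT ?andbF ?orbT ?orbF /=).

Ltac split_edge x y := case: (eqVneq x y) => [->|?]; eqs; try done.

(** * The step c1: a contraction above a cut *)

Definition c1_redex A g n e1 e2 e e3 k n1 n2 d1 d2 : Prop :=
  (g \in fV A) /\ (lab A g = Ctr) /\ (n \in fV A) /\ (lab A n = Cut) /\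
  ((e1 \in fE A) /\ (e2 \in fE A) /\ (e1 != e2) /\ (lo A e1 = Some g) /\ (lo A e2 = Some g)) /\
  ((e \in fE A) /\ (up A e = Some g) /\ (lo A e = Some n) /\
   (e3 \in fE A) /\ (e3 != e) /\ (lo A e3 = Some n)) /\
  uniq [:: k, n1, n2 & fV A] /\ uniq [:: d1, d2 & fE A].

(** The step relation is split into side conditions and a named result, so that properties of the
    result can be stated separately. *)
Definition c1_flow A g n e1 e2 e e3 k n1 n2 d1 d2 : flow :=
  Flow [:: k, n1, n2 & [seq x <- fV A | x \notin [:: g; n]]]
       [:: d1, d2 & [seq x <- fE A | x != e]]
       (fun x => if x == k then Coctr else if x == n1 then Cut
                 else if x == n2 then Cut else lab A x)
       (fun x => if x == d1 then Some k else if x == d2 then Some k else up A x)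
       (fun x => if x == e3 then Some k else if x == e1 then Some n1
                 else if x == d1 then Some n1 else if x == e2 then Some n2
                 else if x == d2 then Some n2 else lo A x).

Section C1.
Variables (A : flow) (pi : nat -> bool) (h : nat -> nat).
Variables (g n e1 e2 e e3 k n1 n2 d1 d2 : nat).
Hypotheses (pf : preflow A pi) (rk : ranked A h).
Hypothesis redex : c1_redex A g n e1 e2 e e3 k n1 n2 d1 d2.
Let B := c1_flow A g n e1 e2 e e3 k n1 n2 d1 d2.

Let gV : g \in fV A. Proof. by move: redex; rewrite /c1_redex; do ?split; tauto. Qed.
Let lg : lab A g = Ctr. Proof. by move: redex; rewrite /c1_redex; do ?split; tauto. Qed.
Let nV : n \in fV A. Proof. by move: redex; rewrite /c1_redex; do ?split; tauto. Qed.
Let ln : lab A n = Cut. Proof. by move: redex; rewrite /c1_redex; do ?split; tauto. Qed.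
Let upg : [/\ e1 \in fE A, e2 \in fE A, e1 != e2, lo A e1 = Some g & lo A e2 = Some g].
Proof. by move: redex; rewrite /c1_redex; do ?split; tauto. Qed.
Let upn : [/\ e \in fE A, e3 \in fE A, e3 != e, lo A e = Some n & lo A e3 = Some n].
Proof. by move: redex; rewrite /c1_redex; do ?split; tauto. Qed.
Let ue : up A e = Some g.
Proof. by move: redex; rewrite /c1_redex; do ?split; tauto. Qed.
Let uV : uniq [:: k, n1, n2 & fV A].
Proof. by move: redex; rewrite /c1_redex; do ?split; tauto. Qed.
Let uE : uniq [:: d1, d2 & fE A].
Proof. by move: redex; rewrite /c1_redex; do ?split; tauto. Qed.

Lemma c1_old_stars :
  has_star A g Ctr [:: e1; e2] [:: e] /\ has_star A n Cut [:: e; e3] [::].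
Proof.
have [sg tg] := arityP pf gV; have [sn tn] := arityP pf nV.
have [e1E e2E e12 l1 l2] := upg; have [eE e3E e3e le l3] := upn.
rewrite lg ln in sg tg sn tn.
split; split=> //; (apply: upper_perm || apply: lower_perm) => //=; try exact: pf_uniqE pf.
- by rewrite inE e12.
- by move=> x; rewrite !inE mem_upper => /orP[]/eqP->; apply/andP; split=> //; apply/eqP.
- by move=> x; rewrite !inE mem_lower => /eqP->; apply/andP; split=> //; apply/eqP.
- by rewrite inE eq_sym e3e.
- by move=> x; rewrite !inE mem_upper => /orP[]/eqP->; apply/andP; split=> //; apply/eqP.
Qed.

(** Determines every vertex of the result; signs and weights are later read off from it. The old
    edges are told apart by their lower endpoints, as [g] and [n] have different labels, and no old
    edge touches a fresh vertex. *)
Lemma c1_stars :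
  has_star B k Coctr [:: e3] [:: d1; d2] /\ has_star B n1 Cut [:: e1; d1] [::] /\
  has_star B n2 Cut [:: e2; d2] [::] /\
  forall v, v \in fV A -> v \notin [:: g; n] -> same_star A B v.
Proof.
have [e1E e2E e12 l1 l2] := upg; have [eE e3E e3e le l3] := upn.
have ng : n != g by apply: contra_eq_neq ln => ->; rewrite lg.
have e1e : e1 != e.
  by apply: contraNneq ng => E; move: l1; rewrite E le => -[->].
have e2e : e2 != e.
  by apply: contraNneq ng => E; move: l2; rewrite E le => -[->].
have e31 : e3 != e1.
  by apply: contraNneq ng => E; move: l1; rewrite -E l3 => -[->].
have e32 : e3 != e2.
  by apply: contraNneq ng => E; move: l2; rewrite -E l3 => -[->].
move: uV uE; rewrite /= !inE !negb_or -!andbA.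
move=> /and5P[kn1 kn2 kV n12 /and3P[n1V n2V _]] /and4P[d12 d1E d2E _].
have nlo x v : v \notin fV A -> x \in fE A -> (lo A x == Some v) = false.
  by move=> vN xE; apply: contraNF vN => /eqP; apply: preflow_lo pf xE.
have nup x v : v \notin fV A -> x \in fE A -> (up A x == Some v) = false.
  by move=> vN xE; apply: contraNF vN => /eqP; apply: preflow_up pf xE.
have uE' : uniq (fE B).
  apply: subseq_uniq uE; exact: (cat_subseq (subseq_refl [:: d1; d2]) (filter_subseq _ _)).
have star v kd us ls : lab B v = kd -> uniq us -> uniq ls ->
    upper B v =i us -> lower B v =i ls -> has_star B v kd us ls.
  by move=> kv us_u ls_u eu el; split=> //; apply: uniq_perm => //; exact: filter_uniq.
have edges x : x \in fE B = [|| x == d1, x == d2 | (x != e) && (x \in fE A)].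
  by rewrite !inE mem_filter.
split; [|split; [|split]].
- apply: star; rewrite /= ?inE ?d12; eqs => //.
  + move=> x; rewrite mem_upper edges /= !inE.
    split_edge x e3; split_edge x e1; split_edge x d1; split_edge x e2; split_edge x d2.
    by case xE: (x \in fE A); rewrite ?andbF //= nlo ?andbF.
  + move=> x; rewrite mem_lower edges /= !inE.
    split_edge x d1; split_edge x d2.
    by case xE: (x \in fE A); rewrite ?andbF //= nup ?andbF.
- apply: star; rewrite /= ?inE; eqs => //.
  + move=> x; rewrite mem_upper edges /= !inE.
    split_edge x e3; split_edge x e1; split_edge x d1; split_edge x e2; split_edge x d2.
    by case xE: (x \in fE A); rewrite ?andbF //= nlo ?andbF.
  + move=> x; rewrite mem_lower edges /= ?in_nil.
    split_edge x d1; split_edge x d2.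
    by case xE: (x \in fE A); rewrite ?andbF //= nup ?andbF.
- apply: star; rewrite /= ?inE; eqs => //.
  + move=> x; rewrite mem_upper edges /= !inE.
    split_edge x e3; split_edge x e1; split_edge x d1; split_edge x e2; split_edge x d2.
    by case xE: (x \in fE A); rewrite ?andbF //= nlo ?andbF.
  + move=> x; rewrite mem_lower edges /= ?in_nil.
    split_edge x d1; split_edge x d2.
    by case xE: (x \in fE A); rewrite ?andbF //= nup ?andbF.
move=> v vV; rewrite !inE negb_or => /andP[vg vn]; split; rewrite /= ?/upper ?/lower /=; eqs => //.
  rewrite -filter_predI; apply: eq_in_filter => x xE /=.
  split_edge x e3; split_edge x e1; split_edge x d1; split_edge x e2; split_edge x d2; split_edge x e.
rewrite -filter_predI; apply: eq_in_filter => x xE /=.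
have [xd1 xd2] := (mem_neq xE d1E, mem_neq xE d2E); eqs.
by split_edge x e.
Qed.

(** The new edges take the sign of [e3], so the new cocontraction has a single sign. That sign is
    opposite to the one of [e], hence to those of [e1] and [e2], as the new cuts require. *)
Lemma c1_preflow :
  preflow B (fun x => if x \in [:: d1; d2] then pi e3 else pi x).
Proof.
have [e1E e2E e12 l1 l2] := upg; have [eE e3E e3e le l3] := upn.
have [[_ ug_ lg_] [_ un_ ln_]] := c1_old_stars.
have [sk [s1 [s2 kept]]] := c1_stars.
move: uV uE; rewrite /= !inE !negb_or -!andbA.
move=> /and5P[kn1 kn2 kV n12 /and3P[n1V n2V _]] /and4P[d12 d1E d2E _].
split.
- apply: subseq_uniq uV; exact: (cat_subseq (subseq_refl [:: k; n1; n2]) (filter_subseq _ _)).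
- apply: subseq_uniq uE; exact: (cat_subseq (subseq_refl [:: d1; d2]) (filter_subseq _ _)).
- move=> x; rewrite !inE mem_filter => xE; rewrite /endpoint_ok /=.
  have {xE} [x1|[x2|[xe xE]]] : x = d1 \/ x = d2 \/ x != e /\ x \in fE A.
    by case/or3P: xE => [/eqP|/eqP|/andP[]]; auto.
  + by rewrite x1; eqs; rewrite !inE; eqs.
  + by rewrite x2; eqs; rewrite !inE; eqs.
  split.
    have [xd1 xd2] := (mem_neq xE d1E, mem_neq xE d2E); eqs.
    (* No surviving edge leaves a deleted vertex: [e] is the only lower edge of [g], and [n] has
       none. *)
    case u: (up A x) => [v|//]; rewrite !inE mem_filter !inE (preflow_up pf xE u) negb_or.
    suff -> : (v != g) && (v != n) by rewrite ?orbT.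
    apply/andP; split; apply/eqP => E; rewrite E in u.
      by have := perm_mem lg_ x; rewrite mem_lower xE u eqxx inE; eqs.
    by have := perm_mem ln_ x; rewrite mem_lower xE u eqxx.
  have [xd1 xd2] := (mem_neq xE d1E, mem_neq xE d2E); eqs.
  case: (eqVneq x e3) => x3; first by rewrite !inE eqxx.
  case: (eqVneq x e1) => x1; first by rewrite !inE eqxx !orbT.
  case: (eqVneq x e2) => x2; first by rewrite !inE eqxx !orbT.
  (* The edges that entered [g] or [n] are [e1], [e2], [e3], which are redirected, and the deleted
     [e]. *)
  case u: (lo A x) => [v|//]; rewrite !inE mem_filter !inE (preflow_lo pf xE u) negb_or.
  suff -> : (v != g) && (v != n) by rewrite ?orbT.
  apply/andP; split; apply/eqP => E; rewrite E in u.
    by have := perm_mem ug_ x; rewrite mem_upper xE u eqxx !inE; eqs.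
  by have := perm_mem un_ x; rewrite mem_upper xE u eqxx !inE; eqs.
have sg : pi e1 = pi e /\ pi e2 = pi e.
  have := @signs_at _ _ pf g _ _ gV; rewrite lg => sg.
  by split; apply: sg; rewrite mem_cat (perm_mem ug_) (perm_mem lg_) !inE eqxx ?orbT.
have sn : pi e3 != pi e.
  have := @signs_at _ _ pf n e3 e nV; rewrite ln; apply=> //;
  by rewrite mem_cat (perm_mem un_) (perm_mem ln_) !inE eqxx ?orbT.
have [d13 d23] := (mem_neq e3E d1E, mem_neq e3E d2E).
have [d11 d21] := (mem_neq e1E d1E, mem_neq e1E d2E).
have [d12' d22] := (mem_neq e2E d1E, mem_neq e2E d2E).
have explicit v kd us ls pi' : has_star B v kd us ls -> local_ok pi' kd us ls ->
   local_ok pi' (lab B v) (upper B v) (lower B v).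
  by move=> [-> pu pl]; apply: local_ok_perm => //; rewrite perm_sym.
move=> v; rewrite !inE mem_filter => /or4P[/eqP->|/eqP->|/eqP->|/andP[vo vV]].
- apply: explicit sk _; split=> // a b; rewrite /= !inE.
  by move=> /or3P[]/eqP-> /or3P[]/eqP->; eqs.
- apply: explicit s1 _; split=> // a b; rewrite /= !inE.
  by move=> /orP[]/eqP-> /orP[]/eqP->; rewrite ?eqxx //; eqs; rewrite sg.1 // eq_sym.
- apply: explicit s2 _; split=> // a b; rewrite /= !inE.
  by move=> /orP[]/eqP-> /orP[]/eqP->; rewrite ?eqxx //; eqs; rewrite sg.2 // eq_sym.
have [-> -> ->] := kept v vV vo; have [ar sgv] := pf_local pf vV; split=> //.
apply: signs_perm sgv => // x xs.
have xE : x \in fE A by move: xs; rewrite mem_cat mem_upper mem_lower => /orP[]/andP[].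
have [xd1 xd2] := (mem_neq xE d1E, mem_neq xE d2E).
by rewrite !inE; eqs.
Qed.

Lemma c1_ranked : exists h', ranked B h'.
Proof.
have [e1E e2E e12 l1 l2] := upg; have [eE e3E e3e le l3] := upn.
have [[_ ug_ lg_] [_ un_ ln_]] := c1_old_stars.
move: uV uE; rewrite /= !inE !negb_or -!andbA.
move=> /and5P[kn1 kn2 kV n12 /and3P[n1V n2V _]] /and4P[d12 d1E d2E _].
(* Doubling the ranks makes room for [k] strictly between the new cuts, which inherit the place of
   [n], and whatever was above [n]. *)
pose h' x := if x == k then (h n).*2.+1 else if x \in [:: n1; n2] then (h n).*2 else (h x).*2.
have [hk [h1 h2]] : h' k = (h n).*2.+1 /\ h' n1 = (h n).*2 /\ h' n2 = (h n).*2.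
  by rewrite /h' !inE; eqs.
have old v : v \in fV A -> h' v = (h v).*2 by move=> vV; rewrite /h' !inE; eqs.
exists h' => x u w.
rewrite !inE mem_filter /= => xE.
have gn := rk eE ue le.
have {xE} [->|[->|[xe xE]]] : x = d1 \/ x = d2 \/ x != e /\ x \in fE A.
  by case/or3P: xE => [/eqP|/eqP|/andP[]]; auto.
- have [a b] := (mem_neq e3E d1E, mem_neq e1E d1E).
  by eqs => -[<-] [<-]; rewrite hk h1.
- have [a b] := (mem_neq e3E d2E, mem_neq e1E d2E); have c := mem_neq e2E d2E.
  by eqs => -[<-] [<-]; rewrite hk h2.
have [xd1 xd2] := (mem_neq xE d1E, mem_neq xE d2E); eqs => xu.
have uV' := preflow_up pf xE xu; rewrite (old u) //.
case: (eqVneq x e3) xu => [->|x3] xu.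
  by move=> /= -[<-]; rewrite hk ltn_Sdouble (rk e3E xu l3).
case: (eqVneq x e1) xu => [->|x1] xu.
  by move=> /= -[<-]; rewrite h1 ltn_double (ltn_trans gn (rk e1E xu l1)).
case: (eqVneq x e2) xu => [->|x2] xu.
  by move=> /= -[<-]; rewrite h2 ltn_double (ltn_trans gn (rk e2E xu l2)).
by move=> l; rewrite old ?(preflow_lo pf xE l) // ltn_double (rk xE xu l).
Qed.

End C1.

(** * Turning flows upside down; the step c2 as the dual of c1 *)

Definition dual_kind k := match k with
  | Int => Cut | Cut => Int | Wk => Cowk | Cowk => Wk | Ctr => Coctr | Coctr => Ctr end.

Definition dual F :=
  Flow (fV F) (fE F) (fun v => dual_kind (lab F v)) (lo F) (up F).

Lemma local_ok_dual pi k us ls : local_ok pi k us ls -> local_ok pi (dual_kind k) ls us.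
Proof.
move=> [ar sg]; split; first by case: k ar {sg} => -[-> ->].
have : signs pi k (ls ++ us) by apply: signs_perm sg => // x; rewrite !mem_cat orbC.
by case: (k).
Qed.

Lemma preflow_dual F pi : preflow F pi -> preflow (dual F) pi.
Proof.
case=> uV uE ends loc; split=> //.
  by move=> e /ends[].
by move=> v /loc /local_ok_dual.
Qed.

(** The new rank is the distance to the maximal rank on [fV F]. *)
Lemma ranked_dual F pi h : preflow F pi -> ranked F h -> exists h', ranked (dual F) h'.
Proof.
move=> pf rk; exists (fun v => \max_(x <- fV F) h x - h v) => e u w eE /= l u'.
have lt := rk _ _ _ eE u' l; apply: ltn_sub2l => //.
apply: leq_trans lt (leq_bigmax_seq _ _ _) => //; exact: preflow_up pf eE u'.
Qed.

Definition c2_redex A i k e1 e2 e3 e4 g i1 i2 d1 d2 : Prop :=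
  (i \in fV A) /\ (lab A i = Int) /\ (k \in fV A) /\ (lab A k = Coctr) /\
  ((e3 \in fE A) /\ (e4 \in fE A) /\ (e3 != e4) /\ (up A e3 = Some i) /\ (up A e4 = Some i)) /\
  ((lo A e4 = Some k) /\ (e1 \in fE A) /\ (e2 \in fE A) /\ (e1 != e2) /\
   (up A e1 = Some k) /\ (up A e2 = Some k)) /\
  uniq [:: g, i1, i2 & fV A] /\ uniq [:: d1, d2 & fE A].

Definition c2_flow A i k e1 e2 e3 e4 g i1 i2 d1 d2 : flow :=
  Flow [:: g, i1, i2 & [seq x <- fV A | x \notin [:: i; k]]]
       [:: d1, d2 & [seq x <- fE A | x != e4]]
       (fun x => if x == g then Ctr else if x == i1 then Int
                 else if x == i2 then Int else lab A x)
       (fun x => if x == e3 then Some g else if x == e1 then Some i1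
                 else if x == d1 then Some i1 else if x == e2 then Some i2
                 else if x == d2 then Some i2 else up A x)
       (fun x => if x == d1 then Some g else if x == d2 then Some g else lo A x).

Lemma dual_kindK : involutive dual_kind. Proof. by case. Qed.

Section C2.
Variables (A : flow) (pi : nat -> bool) (h : nat -> nat).
Variables (i k e1 e2 e3 e4 g i1 i2 d1 d2 : nat).
Hypotheses (pf : preflow A pi) (rk : ranked A h).
Hypothesis redex : c2_redex A i k e1 e2 e3 e4 g i1 i2 d1 d2.
Let B := c2_flow A i k e1 e2 e3 e4 g i1 i2 d1 d2.
(** Upside down, the cocontraction [k] is a contraction whose lower edge [e4] enters the cut [i],
    with [e3] as the other edge of the cut. *)
Let B' := c1_flow (dual A) k i e1 e2 e4 e3 g i1 i2 d1 d2.

Let dual_redex : c1_redex (dual A) k i e1 e2 e4 e3 g i1 i2 d1 d2.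
Proof.
by move: redex => [? [li [? [lk ?]]]]; rewrite /c1_redex /= li lk; tauto.
Qed.

(** [B] is the dual of [B'] only pointwise: edges and endpoint maps agree by conversion, labels
    after a double dualisation, and vertex lists after swapping [i] and [k] in the filter. *)
Let lab_dual v : lab B v = dual_kind (lab B' v).
Proof. by rewrite /=; do 3!case: ifP => //; rewrite dual_kindK. Qed.

Let fV_dual : fV B = fV B'.
Proof. by rewrite /=; do 3!congr cons; apply: eq_filter => x; rewrite !inE orbC. Qed.

Lemma c2_old_stars :
  has_star A k Coctr [:: e4] [:: e1; e2] /\ has_star A i Int [::] [:: e4; e3].
Proof.
have [sk si] := c1_old_stars (preflow_dual pf) dual_redex.
by split; [move: redex => [_ [_ [_ [lk _]]]] | move: redex => [_ [li _]]]; split=> //;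
  [case: sk | case: sk | case: si | case: si].
Qed.

Lemma c2_stars :
  has_star B g Ctr [:: d1; d2] [:: e3] /\ has_star B i1 Int [::] [:: e1; d1] /\
  has_star B i2 Int [::] [:: e2; d2] /\
  forall v, v \in fV A -> v \notin [:: i; k] -> same_star A B v.
Proof.
have [sg [s1 [s2 kept]]] := c1_stars (preflow_dual pf) dual_redex.
have flip v kd us ls : has_star B' v kd us ls -> has_star B v (dual_kind kd) ls us.
  by case=> <- ? ?; split; rewrite ?lab_dual.
split; first exact: flip sg.
split; first exact: flip s1.
split; first exact: flip s2.
move=> v vV; rewrite !inE orbC => vo.
have [] := kept v vV; first by rewrite !inE.
by move=> lv uv lv'; split; rewrite ?lab_dual ?lv /= ?dual_kindK.
Qed.

Lemma c2_preflow :
  preflow B (fun x => if x \in [:: d1; d2] then pi e3 else pi x).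
Proof.
have [uV uE ends loc] := c1_preflow (preflow_dual pf) dual_redex.
split; rewrite ?fV_dual //.
  by move=> x /ends[]; rewrite /endpoint_ok fV_dual.
by move=> v /loc /local_ok_dual; rewrite lab_dual.
Qed.

Lemma c2_ranked : exists h', ranked B h'.
Proof.
have [h1 rk1] := ranked_dual pf rk.
have [h2 rk2] := c1_ranked (preflow_dual pf) rk1 dual_redex.
exact: ranked_dual (c1_preflow (preflow_dual pf) dual_redex) rk2.
Qed.

End C2.

(** * The step c3: a contraction above a cocontraction *)

Definition c3_redex A g k e1 e2 e e3 e4 k1 k2 g3 g4 d13 d14 d23 d24 : Prop :=
  (g \in fV A) /\ (lab A g = Ctr) /\ (k \in fV A) /\ (lab A k = Coctr) /\
  ((e1 \in fE A) /\ (e2 \in fE A) /\ (e1 != e2) /\ (lo A e1 = Some g) /\ (lo A e2 = Some g)) /\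
  ((e \in fE A) /\ (up A e = Some g) /\ (lo A e = Some k) /\ (e3 \in fE A) /\ (e4 \in fE A) /\
   (e3 != e4) /\ (up A e3 = Some k /\ up A e4 = Some k)) /\
  uniq [:: k1, k2, g3, g4 & fV A] /\ uniq [:: d13, d14, d23, d24 & fE A].

Definition c3_flow A g k e1 e2 e e3 e4 k1 k2 g3 g4 d13 d14 d23 d24 : flow :=
  Flow [:: k1, k2, g3, g4 & [seq x <- fV A | x \notin [:: g; k]]]
       [:: d13, d14, d23, d24 & [seq x <- fE A | x != e]]
       (fun x => if x == k1 then Coctr else if x == k2 then Coctr
                 else if x == g3 then Ctr else if x == g4 then Ctr else lab A x)
       (fun x => if x == e3 then Some g3 else if x == e4 then Some g4
                 else if x == d13 then Some k1 else if x == d14 then Some k1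
                 else if x == d23 then Some k2 else if x == d24 then Some k2
                 else up A x)
       (fun x => if x == e1 then Some k1 else if x == e2 then Some k2
                 else if x == d13 then Some g3 else if x == d23 then Some g3
                 else if x == d14 then Some g4 else if x == d24 then Some g4
                 else lo A x).

Section C3.
Variables (A : flow) (pi : nat -> bool) (h : nat -> nat).
Variables (g k e1 e2 e e3 e4 k1 k2 g3 g4 d13 d14 d23 d24 : nat).
Hypotheses (pf : preflow A pi) (rk : ranked A h).
Hypothesis redex : c3_redex A g k e1 e2 e e3 e4 k1 k2 g3 g4 d13 d14 d23 d24.
Let B := c3_flow A g k e1 e2 e e3 e4 k1 k2 g3 g4 d13 d14 d23 d24.

Let gV : g \in fV A. Proof. by move: redex; rewrite /c3_redex; tauto. Qed.
Let lg : lab A g = Ctr. Proof. by move: redex; rewrite /c3_redex; tauto. Qed.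
Let kV : k \in fV A. Proof. by move: redex; rewrite /c3_redex; tauto. Qed.
Let lk : lab A k = Coctr. Proof. by move: redex; rewrite /c3_redex; tauto. Qed.
Let upg : [/\ e1 \in fE A, e2 \in fE A, e1 != e2, lo A e1 = Some g & lo A e2 = Some g].
Proof. by move: redex; rewrite /c3_redex; split; tauto. Qed.
Let lowk : [/\ e3 \in fE A, e4 \in fE A, e3 != e4, up A e3 = Some k & up A e4 = Some k].
Proof. by move: redex; rewrite /c3_redex; split; tauto. Qed.
Let mid : [/\ e \in fE A, up A e = Some g & lo A e = Some k].
Proof. by move: redex; rewrite /c3_redex; split; tauto. Qed.
Let uV : uniq [:: k1, k2, g3, g4 & fV A].
Proof. by move: redex; rewrite /c3_redex; tauto. Qed.
Let uE : uniq [:: d13, d14, d23, d24 & fE A].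
Proof. by move: redex; rewrite /c3_redex; tauto. Qed.

Lemma c3_old_stars :
  has_star A g Ctr [:: e1; e2] [:: e] /\ has_star A k Coctr [:: e] [:: e3; e4].
Proof.
have [sg tg] := arityP pf gV; have [sk tk] := arityP pf kV.
have [e1E e2E e12 l1 l2] := upg; have [e3E e4E e34 u3 u4] := lowk.
have [eE ue le] := mid; rewrite lg lk in sg tg sk tk.
split; split=> //; (apply: upper_perm || apply: lower_perm) => //=; try exact: pf_uniqE pf;
  rewrite ?inE ?e12 ?e34 // => x; rewrite !inE ?mem_upper ?mem_lower.
- by move=> /orP[]/eqP->; apply/andP; split=> //; apply/eqP.
- by move=> /eqP->; apply/andP; split=> //; apply/eqP.
- by move=> /eqP->; apply/andP; split=> //; apply/eqP.
- by move=> /orP[]/eqP->; apply/andP; split=> //; apply/eqP.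
Qed.

(** Acyclicity enters here: an edge both leaving [k] and entering [g] would close a directed cycle
    with [e]. *)
Let distinct : [/\ e1 != e, e2 != e, e3 != e & e4 != e] /\
  [/\ e1 != e3, e1 != e4, e2 != e3 & e2 != e4].
Proof.
have [e1E e2E e12 l1 l2] := upg; have [e3E e4E e34 u3 u4] := lowk.
have [eE ue le] := mid.
have kg : k != g by apply: contra_eq_neq lk => ->; rewrite lg.
have nlo x : lo A x = Some g -> x != e.
  by move=> l; apply: contraNneq kg => E; move: l; rewrite E le => -[->].
have nup x : up A x = Some k -> x != e.
  by move=> u; apply: contraNneq kg => E; move: u; rewrite E ue => -[->].
have cross x y : x \in fE A -> lo A x = Some g -> up A y = Some k -> x != y.
  move=> xE l u; apply/eqP => E; rewrite -E in u.
  by have := ltn_trans (rk xE u l) (rk eE ue le); rewrite ltnn.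
by do !split; auto.
Qed.

Lemma c3_stars :
  (has_star B k1 Coctr [:: e1] [:: d13; d14] /\ has_star B k2 Coctr [:: e2] [:: d23; d24]) /\
  (has_star B g3 Ctr [:: d13; d23] [:: e3] /\ has_star B g4 Ctr [:: d14; d24] [:: e4]) /\
  forall v, v \in fV A -> v \notin [:: g; k] -> same_star A B v.
Proof.
have [e1E e2E e12 l1 l2] := upg; have [e3E e4E e34 u3 u4] := lowk.
have [eE ue le] := mid.
have [[e1e e2e e3e e4e] [e13 e14 e23 e24]] := distinct.
have uE' : uniq (fE B).
  apply: subseq_uniq uE.
  exact: (cat_subseq (subseq_refl [:: d13; d14; d23; d24]) (filter_subseq _ _)).
move: uV uE; rewrite /= !inE !negb_or -!andbA.
move=> /and5P[k12 k1g3 k1g4 k1V /and5P[k2g3 k2g4 k2V g34 /and3P[g3V g4V _]]].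
move=> /and5P[da db dc d13E /and5P[dd de d14E df /and3P[d23E d24E _]]].
have nlo x v : v \notin fV A -> x \in fE A -> (lo A x == Some v) = false.
  by move=> vN xE; apply: contraNF vN => /eqP; apply: preflow_lo pf xE.
have nup x v : v \notin fV A -> x \in fE A -> (up A x == Some v) = false.
  by move=> vN xE; apply: contraNF vN => /eqP; apply: preflow_up pf xE.
have star v kd us ls : lab B v = kd -> uniq us -> uniq ls ->
    upper B v =i us -> lower B v =i ls -> has_star B v kd us ls.
  by move=> kv us_u ls_u eu el; split=> //; apply: uniq_perm => //; exact: filter_uniq.
have edges x : x \in fE B =
    [|| x == d13, x == d14, x == d23, x == d24 | (x != e) && (x \in fE A)].
  by rewrite !inE mem_filter.
split; [split|split; [split|]].
1-4: apply: star; rewrite /= ?inE; eqs => // x; rewrite ?mem_upper ?mem_lower edges /= !inE;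
  split_edge x d13; split_edge x d14; split_edge x d23; split_edge x d24;
  split_edge x e1; try (by rewrite nup); split_edge x e2; try (by rewrite nup);
  split_edge x e3; try (by rewrite nlo); split_edge x e4; try (by rewrite nlo);
  by case xE: (x \in fE A); rewrite ?andbF //= ?nlo ?nup ?andbF.
move=> v vV; rewrite !inE negb_or => /andP[vg vk]; split; rewrite /= ?/upper ?/lower /=; eqs => //.
  rewrite -filter_predI; apply: eq_in_filter => x xE /=.
  have [x1 x2] := (mem_neq xE d13E, mem_neq xE d14E).
  have [x3 x4] := (mem_neq xE d23E, mem_neq xE d24E); eqs.
  by split_edge x e1; split_edge x e2; split_edge x e.
rewrite -filter_predI; apply: eq_in_filter => x xE /=.
have [x1 x2] := (mem_neq xE d13E, mem_neq xE d14E).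
have [x3 x4] := (mem_neq xE d23E, mem_neq xE d24E); eqs.
by split_edge x e3; split_edge x e4; split_edge x e.
Qed.

(** All edges at [g] and [k] have the sign of [e]; the new edges take it too, so each new vertex
    sees one sign. *)
Lemma c3_preflow :
  preflow B (fun x => if x \in [:: d13; d14; d23; d24] then pi e else pi x).
Proof.
have [e1E e2E e12 l1 l2] := upg; have [e3E e4E e34 u3 u4] := lowk.
have [eE ue le] := mid.
have [[e1e e2e e3e e4e] [e13 e14 e23 e24]] := distinct.
have [[_ ug_ lg_] [_ uk_ lk_]] := c3_old_stars.
have [[s1 s2] [[s3 s4] kept]] := c3_stars.
move: uV uE; rewrite /= !inE !negb_or -!andbA.
move=> /and5P[k12 k1g3 k1g4 k1V /and5P[k2g3 k2g4 k2V g34 /and3P[g3V g4V _]]].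
move=> /and5P[da db dc d13E /and5P[dd de d14E df /and3P[d23E d24E _]]].
split.
- apply: subseq_uniq uV.
  exact: (cat_subseq (subseq_refl [:: k1; k2; g3; g4]) (filter_subseq _ _)).
- apply: subseq_uniq uE.
  exact: (cat_subseq (subseq_refl [:: d13; d14; d23; d24]) (filter_subseq _ _)).
- move=> x xE; rewrite /endpoint_ok /=.
  have {xE} : x \in [:: d13; d14; d23; d24] \/ x != e /\ x \in fE A.
    move: xE; rewrite -[fE B]/([:: d13; d14; d23; d24] ++ _) mem_cat mem_filter.
    by case/orP=> [|/andP[]]; auto.
  rewrite !inE; case=> [/or4P[]/eqP->|[xe xE]]; try by eqs; rewrite !inE !eqxx ?orbT.
  have [x1 x2] := (mem_neq xE d13E, mem_neq xE d14E).
  have [x3 x4] := (mem_neq xE d23E, mem_neq xE d24E); eqs.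
  split.
    case: (eqVneq x e3) => y3; first by rewrite !inE eqxx ?orbT.
    case: (eqVneq x e4) => y4; first by rewrite !inE eqxx ?orbT.
    case u: (up A x) => [v|//]; rewrite !inE mem_filter !inE (preflow_up pf xE u) negb_or.
    suff -> : (v != g) && (v != k) by rewrite ?orbT.
    apply/andP; split; apply/eqP => E; rewrite E in u.
      by have := perm_mem lg_ x; rewrite mem_lower xE u eqxx inE; eqs.
    by have := perm_mem lk_ x; rewrite mem_lower xE u eqxx !inE; eqs.
  case: (eqVneq x e1) => y1; first by rewrite !inE eqxx.
  case: (eqVneq x e2) => y2; first by rewrite !inE eqxx !orbT.
  case u: (lo A x) => [v|//]; rewrite !inE mem_filter !inE (preflow_lo pf xE u) negb_or.
  suff -> : (v != g) && (v != k) by rewrite ?orbT.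
  apply/andP; split; apply/eqP => E; rewrite E in u.
    by have := perm_mem ug_ x; rewrite mem_upper xE u eqxx !inE; eqs.
  by have := perm_mem uk_ x; rewrite mem_upper xE u eqxx !inE; eqs.
have [p1 p2] : pi e1 = pi e /\ pi e2 = pi e.
  have := @signs_at _ _ pf g _ _ gV; rewrite lg => sg.
  by split; apply: sg; rewrite mem_cat (perm_mem ug_) (perm_mem lg_) !inE eqxx ?orbT.
have [p3 p4] : pi e3 = pi e /\ pi e4 = pi e.
  have := @signs_at _ _ pf k _ _ kV; rewrite lk => sg.
  by split; apply: sg; rewrite mem_cat (perm_mem uk_) (perm_mem lk_) !inE eqxx ?orbT.
have old x : x \in fE A -> (x \in [:: d13; d14; d23; d24]) = false.
  move=> xE; have [x1 x2] := (mem_neq xE d13E, mem_neq xE d14E).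
  by have [x3 x4] := (mem_neq xE d23E, mem_neq xE d24E); rewrite !inE; eqs.
have explicit v kd us ls : has_star B v kd us ls ->
   (size us, size ls) = arity kd -> kd = Ctr \/ kd = Coctr ->
   {subset us ++ ls <= [:: e1; e2; e3; e4; d13; d14; d23; d24]} ->
   local_ok (fun x => if x \in [:: d13; d14; d23; d24] then pi e else pi x)
      (lab B v) (upper B v) (lower B v).
  move=> [-> pu pl] ar kk sub.
  apply: (local_ok_perm (us := us) (ls := ls)) => //; rewrite 1?perm_sym //.
  have one x : x \in us ++ ls -> (if x \in [:: d13; d14; d23; d24] then pi e else pi x) = pi e.
    case: ifP => // xd /sub; rewrite -[_ :: _]/([:: e1; e2; e3; e4] ++ [:: d13; d14; d23; d24]).
    by rewrite mem_cat xd orbF !inE => /or4P[]/eqP->.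
  by split=> //; case: kk => -> a b /one-> /one->.
move=> v; rewrite -[fV B]/([:: k1; k2; g3; g4] ++ _) mem_cat mem_filter !inE.
case/orP=> [/or4P[]/eqP->|/andP[vo vV]].
- by apply: explicit s1 _ _ _; auto=> // x; rewrite !inE => /or3P[]->; rewrite ?orbT.
- by apply: explicit s2 _ _ _; auto=> // x; rewrite !inE => /or3P[]->; rewrite ?orbT.
- by apply: explicit s3 _ _ _; auto=> // x; rewrite !inE => /or3P[]->; rewrite ?orbT.
- by apply: explicit s4 _ _ _; auto=> // x; rewrite !inE => /or3P[]->; rewrite ?orbT.
have [|-> -> ->] := kept v vV; first by rewrite !inE.
have [ar sgv] := pf_local pf vV; split=> //.
apply: signs_perm sgv => // x xs; rewrite old //.
by move: xs; rewrite mem_cat mem_upper mem_lower => /orP[]/andP[].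
Qed.

Lemma c3_ranked : exists h', ranked B h'.
Proof.
have [e1E e2E e12 l1 l2] := upg; have [e3E e4E e34 u3 u4] := lowk.
have [eE ue le] := mid.
have [[e1e e2e e3e e4e] [e13 e14 e23 e24]] := distinct.
move: uV uE; rewrite /= !inE !negb_or -!andbA.
move=> /and5P[k12 k1g3 k1g4 k1V /and5P[k2g3 k2g4 k2V g34 /and3P[g3V g4V _]]].
move=> /and5P[da db dc d13E /and5P[dd de d14E df /and3P[d23E d24E _]]].
(* Each new edge descends exactly as [e] did, from the rank of [g] to that of [k]. *)
pose h' x := if x \in [:: k1; k2] then h g else if x \in [:: g3; g4] then h k else h x.
have [hk1 hk2] : h' k1 = h g /\ h' k2 = h g by rewrite /h' !inE; eqs.
have [hg3 hg4] : h' g3 = h k /\ h' g4 = h k by rewrite /h' !inE; eqs.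
have old v : v \in fV A -> h' v = h v by move=> vV; rewrite /h' !inE; eqs.
have gk := rk eE ue le.
exists h' => x u w xE.
have {xE} : x \in [:: d13; d14; d23; d24] \/ x != e /\ x \in fE A.
  by move: xE; rewrite -[fE B]/([:: d13; d14; d23; d24] ++ _) mem_cat mem_filter => /orP[|/andP[]]; auto.
rewrite !inE; case=> [/or4P[]/eqP->|[xe xE]];
  try by rewrite /=; eqs => -[<-] [<-]; rewrite ?hk1 ?hk2 ?hg3 ?hg4.
have [x1 x2] := (mem_neq xE d13E, mem_neq xE d14E).
have [x3 x4] := (mem_neq xE d23E, mem_neq xE d24E); rewrite /=; eqs.
case: (eqVneq x e3) => [->|y3].
  by eqs => -[<-] l; rewrite hg3 old ?(preflow_lo pf e3E l) // (rk e3E u3 l).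
case: (eqVneq x e4) => [->|y4].
  by eqs => -[<-] l; rewrite hg4 old ?(preflow_lo pf e4E l) // (rk e4E u4 l).
move=> xu; rewrite (old u) ?(preflow_up pf xE xu) //.
case: (eqVneq x e1) xu => [->|y1] xu; first by move=> -[<-]; rewrite hk1 (rk e1E xu l1).
case: (eqVneq x e2) xu => [->|y2] xu; first by move=> -[<-]; rewrite hk2 (rk e2E xu l2).
by move=> l; rewrite old ?(preflow_lo pf xE l) // (rk xE xu l).
Qed.

End C3.

(** * Termination of the two phases *)

(** Balances a vertex sum before and after a step, stated without subtraction: the change is that
    between the [news] and the [olds]. *)
Lemma sum_replace (s news olds : seq nat) (f g : nat -> nat) :
  uniq s -> uniq olds -> {subset olds <= s} -> {in s, forall v, v \notin olds -> f v = g v} ->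
  \sum_(v <- news ++ [seq v <- s | v \notin olds]) f v + \sum_(v <- olds) g v
  = \sum_(v <- news) f v + \sum_(v <- s) g v.
Proof.
move=> us uo sub fg; rewrite big_cat -addnA; congr (_ + _).
rewrite (bigID (mem olds) _ _ (r := s)) addnC; congr (_ + _).
  rewrite -[RHS]big_filter; apply: perm_big; apply: uniq_perm => // [|x].
    exact: filter_uniq.
  rewrite mem_filter; apply/idP/andP=> [xo|[]//]; split=> //; exact: sub xo.
rewrite big_filter big_seq_cond [RHS]big_seq_cond; apply: eq_bigr => v /andP[]; exact: fg.
Qed.

Lemma c_star_trans A B C : c_star A B -> c_star B C -> c_star A C.
Proof. by elim=> // A' B' C' st _ IH /IH; apply: cs_step st. Qed.

Lemma fresh n (s : seq nat) : uniq s -> exists2 l, size l = n & uniq (l ++ s).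
Proof.
move=> us; elim: n => [|n [l sl ul]]; first by exists [::].
exists ((\max_(x <- l ++ s) x).+1 :: l) => /=; first by rewrite sl.
rewrite ul andbT; apply/negP => xs.
by have := leq_bigmax_seq (P := predT) (F := id) _ xs isT; rewrite /= ltnn.
Qed.

Lemma size2_other (s : seq nat) e : uniq s -> size s = 2 -> e \in s ->
  exists2 e', e' \in s & e' != e.
Proof.
case: s => [|a [|b [|]]] //= /andP[]; rewrite !inE => ab _ _ /orP[]/eqP->.
  by exists b; rewrite ?inE ?eqxx ?orbT // eq_sym.
by exists a; rewrite ?inE ?eqxx.
Qed.

(** The lower edges at [v] all have the sign of [e] if [v] is a contraction or a cocontraction; any
    other vertex with an upper edge has no lower ones. The surplus 2 pays for c3 splitting one
    counted edge into two. *)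
Definition weighted F (pi : nat -> bool) (c : nat -> nat) := forall v e,
  v \in fV F -> e \in upper F v -> pi e ->
  (if lab F v == Coctr then 2 else 0) + \sum_(x <- lower F v) c x <= c e.

(** The successor lets even an edge of weight 0 count, so that c1 always lowers the sum. *)
Definition ctr_weight F (pi : nat -> bool) (c : nat -> nat) v :=
  if lab F v == Ctr then \sum_(x <- lower F v | pi x) (c x).+1 else 0.

Lemma weighted_exists F pi h : preflow F pi -> ranked F h -> exists c, weighted F pi c.
Proof.
move=> pf rk.
(* An edge from the top is placed just above its lower endpoint. Then [hU e] exceeds [h v] for every
   upper edge [e] of [v] and equals it for every lower one. As there are at most two lower edges,
   [2 + 2 * 4 ^ h v <= 4 ^ (h v).+1] suffices, whence base 4. *)
pose hU e := if up F e is Some u then h u else (h (odflt 0 (lo F e))).+1.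
exists (fun e => 4 ^ hU e) => v e vV; rewrite mem_upper => /andP[eE /eqP l] _.
have lt : h v < hU e.
  by rewrite /hU; case u: (up F e) => [u0|]; rewrite ?l //; apply: rk u l.
apply: (@leq_trans (4 ^ (h v).+1)); last by rewrite leq_pexp2l.
have -> : \sum_(x <- lower F v) 4 ^ hU x = size (lower F v) * 4 ^ h v.
  rewrite big_seq (eq_bigr (fun _ => 4 ^ h v)); last first.
    by move=> x; rewrite mem_lower /hU => /andP[_ /eqP->].
  by rewrite -big_seq big_const_seq count_predT iter_addn_0 mulnC.
have [_ ->] := arityP pf vV; have : 0 < 4 ^ h v by rewrite expn_gt0.
by rewrite expnS; case: (lab F v) => /= *; lia.
Qed.

Lemma same_sum (s : seq nat) (P P' : pred nat) (c c' : nat -> nat) :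
  {in s, P =1 P'} -> {in s, c =1 c'} -> \sum_(x <- s | P x) c x = \sum_(x <- s | P' x) c' x.
Proof.
move=> PP cc; rewrite big_seq_cond [RHS]big_seq_cond; apply: eq_big => x.
  by case xs: (x \in s); rewrite //= PP.
by case/andP=> /cc.
Qed.

(** As [e] is positive, [e3] and the new edges are negative; the latter may get weight 0. No
    contraction is created, and the contribution [(c e).+1] of [g] disappears. *)
Lemma c1_weight A pi c g n e1 e2 e e3 k n1 n2 d1 d2 :
  preflow A pi -> weighted A pi c -> pi e ->
  c1_redex A g n e1 e2 e e3 k n1 n2 d1 d2 ->
  let B := c1_flow A g n e1 e2 e e3 k n1 n2 d1 d2 in
  let pi' x := if x \in [:: d1; d2] then pi e3 else pi x in
  exists2 c', weighted B pi' c' &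
    \sum_(v <- fV B) ctr_weight B pi' c' v < \sum_(v <- fV A) ctr_weight A pi c v.
Proof.
move=> pf wt pe redex B pi'.
have [sg sn] := c1_old_stars pf redex.
have [sk [s1 [s2 kept]]] := c1_stars pf redex.
have [gV [lg [nV [ln [_ [[eE [_ [le [e3E [e3e l3]]]]] [_ uE]]]]]]] := redex.
have old x : x \in fE A -> (x \in [:: d1; d2]) = false.
  move: uE; rewrite /= !inE !negb_or -!andbA => /and4P[_ d1E d2E _] xE.
  by have [a b] := (mem_neq xE d1E, mem_neq xE d2E); eqs.
have pe3 : ~~ pi e3.
  have := @signs_at _ _ pf n e3 e nV; rewrite ln pe; case: sn => _ un_ ln_.
  rewrite !mem_cat !(perm_mem un_) !inE !eqxx orbT => /(_ isT isT e3e).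
  by case: (pi e3).
pose c' x := if x \in [:: d1; d2] then 0 else c x.
have memE v x : x \in upper A v ++ lower A v -> x \in fE A.
  by rewrite mem_cat mem_upper mem_lower => /orP[]/andP[].
have cV v : v \in fV B -> [\/ v = k, v = n1, v = n2 | v \in fV A /\ v \notin [:: g; n]].
  rewrite -[fV B]/([:: k; n1; n2] ++ _) mem_cat mem_filter !inE.
  by case/orP=> [/or3P[]/eqP->|/andP[? ?]]; [apply: Or41|apply: Or42|apply: Or43|apply: Or44].
exists c'.
  move=> v x /cV[->|->|->|[vV vo]].
  - case: sk => _ uk lk; rewrite (perm_mem uk) inE => /eqP->.
    by rewrite /pi' old // (negbTE pe3).
  - by case: s1 => -> _ lk _ _; rewrite (perm_big _ lk) big_nil.
  - by case: s2 => -> _ lk _ _; rewrite (perm_big _ lk) big_nil.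
  have [-> -> ->] := kept v vV vo => xu; have xE : x \in fE A by apply: (memE v); rewrite mem_cat xu.
  rewrite /pi' /c' old // => /(wt v x vV xu); congr (_ + _ <= _).
  by apply: same_sum => // y yl; rewrite old // (memE v) // mem_cat yl orbT.
have kn : uniq [:: g; n] by rewrite /= inE andbT; apply/eqP=> E; rewrite E ln in lg.
have sub : {subset [:: g; n] <= fV A} by move=> x; rewrite !inE => /orP[]/eqP->.
have key : {in fV A, forall v, v \notin [:: g; n] -> ctr_weight B pi' c' v = ctr_weight A pi c v}.
  move=> v vV vo; rewrite /ctr_weight; have [-> _ ->] := kept v vV vo; case: ifP => // _.
  by apply: same_sum => x xl; rewrite /pi' /c' old // (memE v) // mem_cat xl orbT.
have wk : ctr_weight B pi' c' k = 0 by rewrite /ctr_weight; case: sk => ->.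
have w1 : ctr_weight B pi' c' n1 = 0 by rewrite /ctr_weight; case: s1 => ->.
have w2 : ctr_weight B pi' c' n2 = 0 by rewrite /ctr_weight; case: s2 => ->.
have wg : ctr_weight A pi c g = (c e).+1.
  by rewrite /ctr_weight lg; case: sg => _ _ l_; rewrite (perm_big _ l_) big_cons big_nil pe /= addn0.
have := sum_replace [:: k; n1; n2] (pf_uniqV pf) kn sub key.
rewrite -[_ ++ _]/(fV B) !big_cons !big_nil wk w1 w2 wg; lia.
Qed.

Lemma c3_weight A pi h c g k e1 e2 e e3 e4 k1 k2 g3 g4 d13 d14 d23 d24 :
  preflow A pi -> ranked A h -> weighted A pi c -> pi e ->
  c3_redex A g k e1 e2 e e3 e4 k1 k2 g3 g4 d13 d14 d23 d24 ->
  let B := c3_flow A g k e1 e2 e e3 e4 k1 k2 g3 g4 d13 d14 d23 d24 in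
  let pi' x := if x \in [:: d13; d14; d23; d24] then pi e else pi x in
  exists2 c', weighted B pi' c' &
    \sum_(v <- fV B) ctr_weight B pi' c' v < \sum_(v <- fV A) ctr_weight A pi c v.
Proof.
move=> pf rk wt pe redex B pi'.
have [sg sk] := c3_old_stars pf redex.
have [[sk1 sk2] [[sg3 sg4] kept]] := c3_stars pf rk redex.
have [gV [lg [kV [lk [up_ [[eE [ue [le [e3E [e4E [e34 _]]]]]] [_ uE]]]]]]] := redex.
have [e1E [e2E _]] := up_.
move: uE; rewrite /= !inE !negb_or -!andbA.
move=> /and5P[da db dc d13E /and5P[dd de d14E df /and3P[d23E d24E _]]].
have old_neq x : x \in fE A -> [/\ x != d13, x != d14, x != d23 & x != d24].
  by move=> xE; split; neq.
have old x : x \in fE A -> (x \in [:: d13; d14; d23; d24]) = false.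
  by move=> /old_neq[? ? ? ?]; rewrite !inE; eqs.
(* A new edge gets the weight of the edge below its contraction. At [k1] and [k2] domination follows
   from [2 + (c e3 + c e4) <= c e] and from [c e] being at most [c e1] and [c e2]. The new
   contractions contribute at most [c e3 + c e4 + 2], less than [(c e).+1]. *)
pose c' x := if x \in [:: d13; d23] then c e3 else if x \in [:: d14; d24] then c e4 else c x.
have c'_old x : x \in fE A -> c' x = c x.
  by move=> /old_neq[? ? ? ?]; rewrite /c' !inE; eqs.
have [cd13 cd23 cd14 cd24] : [/\ c' d13 = c e3, c' d23 = c e3, c' d14 = c e4 & c' d24 = c e4].
  by rewrite /c' !inE; eqs.
have memE v x : x \in upper A v ++ lower A v -> x \in fE A.
  by rewrite mem_cat mem_upper mem_lower => /orP[]/andP[].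
have cV v : v \in fV B -> v \in [:: k1; k2; g3; g4] \/ v \in fV A /\ v \notin [:: g; k].
  by rewrite -[fV B]/([:: k1; k2; g3; g4] ++ _) mem_cat mem_filter => /orP[|/andP[]]; auto.
have ce : 2 + (c e3 + c e4) <= c e.
  have := wt k e kV; case: sk => _ uk_ lk_.
  by rewrite (perm_mem uk_) (perm_big _ lk_) lk !big_cons big_nil /= addn0 inE eqxx; apply.
have cg x : x \in upper A g -> c e <= c x.
  move=> xg; have := wt g x gV xg; case: sg => _ ug_ lg_.
  rewrite lg (perm_big _ lg_) big_cons big_nil /= addn0; apply.
  have := @signs_at _ _ pf g x e gV; rewrite lg => -> //; rewrite mem_cat ?xg //.
  by rewrite (perm_mem lg_) inE eqxx orbT.
have [ce1 ce2] : c e <= c e1 /\ c e <= c e2.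
  by case: sg => _ ug_ _; split; apply: cg; rewrite (perm_mem ug_) !inE eqxx ?orbT.
exists c'.
  move=> v x /cV[|[vV vo]].
    rewrite !inE => /or4P[]/eqP->.
    - case: sk1 => -> u_ l_; rewrite (perm_mem u_) (perm_big _ l_) inE => /eqP-> _.
      by rewrite !big_cons big_nil /= cd13 cd14 c'_old // addn0 (leq_trans ce).
    - case: sk2 => -> u_ l_; rewrite (perm_mem u_) (perm_big _ l_) inE => /eqP-> _.
      by rewrite !big_cons big_nil /= cd23 cd24 c'_old // addn0 (leq_trans ce).
    - case: sg3 => -> u_ l_; rewrite (perm_mem u_) (perm_big _ l_) !inE big_cons big_nil /=.
      by rewrite c'_old // addn0 => /orP[]/eqP->; rewrite ?cd13 ?cd23.
    - case: sg4 => -> u_ l_; rewrite (perm_mem u_) (perm_big _ l_) !inE big_cons big_nil /=.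
      by rewrite c'_old // addn0 => /orP[]/eqP->; rewrite ?cd14 ?cd24.
  have [-> -> ->] := kept v vV vo => xu; have xE : x \in fE A by apply: (memE v); rewrite mem_cat xu.
  rewrite /pi' c'_old // old // => /(wt v x vV xu); congr (_ + _ <= _).
  by apply: same_sum => // y yl; rewrite c'_old // (memE v) // mem_cat yl orbT.
have kn : uniq [:: g; k] by rewrite /= inE andbT; apply/eqP=> E; rewrite E lk in lg.
have sub : {subset [:: g; k] <= fV A} by move=> x; rewrite !inE => /orP[]/eqP->.
have key : {in fV A, forall v, v \notin [:: g; k] -> ctr_weight B pi' c' v = ctr_weight A pi c v}.
  move=> v vV vo; rewrite /ctr_weight; have [-> _ ->] := kept v vV vo; case: ifP => // _.
  apply: same_sum => x xl; rewrite /pi' ?old ?c'_old // (memE v) // mem_cat xl orbT //.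
have w1 : ctr_weight B pi' c' k1 = 0 by rewrite /ctr_weight; case: sk1 => ->.
have w2 : ctr_weight B pi' c' k2 = 0 by rewrite /ctr_weight; case: sk2 => ->.
have w3 : ctr_weight B pi' c' g3 <= (c e3).+1.
  rewrite /ctr_weight; case: sg3 => -> _ l_; rewrite (perm_big _ l_) big_cons big_nil /=.
  by rewrite c'_old // addn0; case: ifP.
have w4 : ctr_weight B pi' c' g4 <= (c e4).+1.
  rewrite /ctr_weight; case: sg4 => -> _ l_; rewrite (perm_big _ l_) big_cons big_nil /=.
  by rewrite c'_old // addn0; case: ifP.
have wg : ctr_weight A pi c g = (c e).+1.
  by rewrite /ctr_weight lg; case: sg => _ _ l_; rewrite (perm_big _ l_) big_cons big_nil pe /= addn0.
have := sum_replace [:: k1; k2; g3; g4] (pf_uniqV pf) kn sub key.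
rewrite -[_ ++ _]/(fV B) !big_cons !big_nil w1 w2 wg.
move: (bigop _ _ _) (bigop _ _ _) (ctr_weight _ _ _ _) (ctr_weight _ _ _ _) (ctr_weight _ _ _ _) ce w3 w4.
clear; lia.
Qed.

(** * Every forbidden edge yields a redex: arities provide the other edges, and fresh names always
    exist *)

Lemma c1_redex_exists A pi e g n : preflow A pi -> e \in fE A ->
  up A e = Some g -> lab A g = Ctr -> lo A e = Some n -> lab A n = Cut ->
  exists e1 e2 e3 k n1 n2 d1 d2, c1_redex A g n e1 e2 e e3 k n1 n2 d1 d2.
Proof.
move=> pf eE ue lg le ln.
have [gV nV] := (preflow_up pf eE ue, preflow_lo pf eE le).
have [sg _] := arityP pf gV; have [sn _] := arityP pf nV; rewrite lg ln in sg sn.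
have uu v : uniq (upper A v) by apply/filter_uniq/(pf_uniqE pf).
have [e1 e1g] : exists e1, e1 \in upper A g.
  by case: (upper A g) sg => // a s _; exists a; rewrite inE eqxx.
have [e2 e2g e21] := size2_other (uu g) sg e1g.
have en : e \in upper A n by rewrite mem_upper eE le eqxx.
have [e3 e3n e3e] := size2_other (uu n) sn en.
have [[|k [|n1 [|n2 [|]]]] // _ uV] := fresh 3 (pf_uniqV pf).
have [[|d1 [|d2 [|]]] // _ uE] := fresh 2 (pf_uniqE pf).
exists e1, e2, e3, k, n1, n2, d1, d2.
move: e1g e2g e3n; rewrite !mem_upper => /andP[? /eqP?] /andP[? /eqP?] /andP[? /eqP?].
by rewrite /c1_redex (eq_sym e1); tauto.
Qed.

Lemma c2_redex_exists A pi e4 i k : preflow A pi -> e4 \in fE A ->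
  up A e4 = Some i -> lab A i = Int -> lo A e4 = Some k -> lab A k = Coctr ->
  exists e1 e2 e3 g i1 i2 d1 d2, c2_redex A i k e1 e2 e3 e4 g i1 i2 d1 d2.
Proof.
move=> pf eE ue li le lk.
have [iV kV] := (preflow_up pf eE ue, preflow_lo pf eE le).
have [e1 [e2 [e3 [g [i1 [i2 [d1 [d2 red]]]]]]]] :=
  @c1_redex_exists (dual A) pi e4 k i (preflow_dual pf) eE le
    (congr1 dual_kind lk) ue (congr1 dual_kind li).
exists e1, e2, e3, g, i1, i2, d1, d2.
by move: red; rewrite /c1_redex /c2_redex /=; tauto.
Qed.

Lemma c3_redex_exists A pi e g k : preflow A pi -> e \in fE A ->
  up A e = Some g -> lab A g = Ctr -> lo A e = Some k -> lab A k = Coctr ->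
  exists e1 e2 e3 e4 k1 k2 g3 g4 d13 d14 d23 d24,
    c3_redex A g k e1 e2 e e3 e4 k1 k2 g3 g4 d13 d14 d23 d24.
Proof.
move=> pf eE ue lg le lk.
have [gV kV] := (preflow_up pf eE ue, preflow_lo pf eE le).
have [sg _] := arityP pf gV; have [_ sk] := arityP pf kV; rewrite lg lk in sg sk.
have uu v : uniq (upper A v) by apply/filter_uniq/(pf_uniqE pf).
have ul v : uniq (lower A v) by apply/filter_uniq/(pf_uniqE pf).
have [e1 e1g] : exists e1, e1 \in upper A g.
  by case: (upper A g) sg => // a s _; exists a; rewrite inE eqxx.
have [e2 e2g e21] := size2_other (uu g) sg e1g.
have [e3 e3k] : exists e3, e3 \in lower A k.
  by case: (lower A k) sk => // a s _; exists a; rewrite inE eqxx.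
have [e4 e4k e43] := size2_other (ul k) sk e3k.
have [[|k1 [|k2 [|g3 [|g4 [|]]]]] // _ uV] := fresh 4 (pf_uniqV pf).
have [[|d13 [|d14 [|d23 [|d24 [|]]]]] // _ uE] := fresh 4 (pf_uniqE pf).
exists e1, e2, e3, e4, k1, k2, g3, g4, d13, d14, d23, d24.
move: e1g e2g e3k e4k; rewrite !mem_upper !mem_lower.
move=> /andP[? /eqP?] /andP[? /eqP?] /andP[? /eqP?] /andP[? /eqP?].
by rewrite /c3_redex (eq_sym e1) (eq_sym e3); tauto.
Qed.

Lemma c1_stepI A g n e1 e2 e e3 k n1 n2 d1 d2 :
  c1_redex A g n e1 e2 e e3 k n1 n2 d1 d2 ->
  c_step A (c1_flow A g n e1 e2 e e3 k n1 n2 d1 d2).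
Proof.
by move=> H; left; exists g, n, e1, e2, e, e3, k, n1, n2, d1, d2; move: H; rewrite /c1_redex; tauto.
Qed.

Lemma c2_stepI A i k e1 e2 e3 e4 g i1 i2 d1 d2 :
  c2_redex A i k e1 e2 e3 e4 g i1 i2 d1 d2 ->
  c_step A (c2_flow A i k e1 e2 e3 e4 g i1 i2 d1 d2).
Proof.
by move=> H; right; left; exists i, k, e1, e2, e3, e4, g, i1, i2, d1, d2; move: H; rewrite /c2_redex; tauto.
Qed.

Lemma c3_stepI A g k e1 e2 e e3 e4 k1 k2 g3 g4 d13 d14 d23 d24 :
  c3_redex A g k e1 e2 e e3 e4 k1 k2 g3 g4 d13 d14 d23 d24 ->
  c_step A (c3_flow A g k e1 e2 e e3 e4 k1 k2 g3 g4 d13 d14 d23 d24).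
Proof.
by move=> H; right; right; exists g, k, e1, e2, e, e3, e4, k1, k2, g3, g4, d13, d14, d23, d24;
  move: H; rewrite /c3_redex; tauto.
Qed.

(** * The two phases and their composition *)

Lemma kupP F e k : kup F e = Some k -> exists2 v, up F e = Some v & lab F v = k.
Proof. by rewrite /kup; case: (up F e) => //= v [<-]; exists v. Qed.

Lemma kloP F e k : klo F e = Some k -> exists2 v, lo F e = Some v & lab F v = k.
Proof. by rewrite /klo; case: (lo F e) => //= v [<-]; exists v. Qed.

(** Induction on the total contraction weight, with signs, rank and weighting generalised: each step
    supplies its own. *)
Lemma reduce_contractions A pi h : preflow A pi -> ranked A h ->
  exists B pi' h', [/\ c_star A B, preflow B pi', ranked B h' & no_ctr_redex B pi'].
Proof.
move=> pf rk; have [c wt] := weighted_exists pf rk.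
have [m] := ubnP (\sum_(v <- fV A) ctr_weight A pi c v).
elim: m A pi h c pf rk wt => // m IH A pi h c pf rk wt lt.
pose redex e := pi e && (kup A e == Some Ctr) &&
  ((klo A e == Some Cut) || (klo A e == Some Coctr)).
have [/hasP[e eE /andP[/andP[pe /eqP ku] kl]]|/hasPn none] := boolP (has redex (fE A)); last first.
  exists A, pi, h; split=> //; first exact: cs_refl.
  move=> e eE pe ku; have := none e eE; rewrite /redex pe ku eqxx /=.
  by rewrite negb_or => /andP[/eqP ? /eqP ?].
have [g ue lg] := kupP ku.
have [B [pi' [h' [c' [st pf' rk' wt' lt']]]]] : exists B pi' h' c',
    [/\ c_step A B, preflow B pi', ranked B h', weighted B pi' c' &
     \sum_(v <- fV B) ctr_weight B pi' c' v < \sum_(v <- fV A) ctr_weight A pi c v].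
  case/orP: kl => /eqP/kloP[v le lv].
    have [e1 [e2 [e3 [k [n1 [n2 [d1 [d2 red]]]]]]]] := c1_redex_exists pf eE ue lg le lv.
    have [c' wt' lt'] := c1_weight pf wt pe red; have [h' rk'] := c1_ranked pf rk red.
    by do 4!eexists; split; [exact: c1_stepI red|exact: c1_preflow pf red|exact: rk'|exact: wt'|].
  have [e1 [e2 [e3 [e4 [k1 [k2 [g3 [g4 [d13 [d14 [d23 [d24 red]]]]]]]]]]]] :=
    c3_redex_exists pf eE ue lg le lv.
  have [c' wt' lt'] := c3_weight pf rk wt pe red; have [h' rk'] := c3_ranked pf rk red.
  by do 4!eexists; split; [exact: c3_stepI red|exact: c3_preflow pf rk red|exact: rk'|exact: wt'|].
have [C [pi'' [h'' [st' ? ? ?]]]] := IH B pi' h' c' pf' rk' wt' (leq_trans lt' lt).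
by exists C, pi'', h''; split=> //; apply: cs_step st st'.
Qed.

(** A cocontraction has a single upper edge, so this is 1 on positive cocontractions and 0 on all
    other vertices. *)
Definition coctr_weight F (pi : nat -> bool) v :=
  if lab F v == Coctr then count pi (upper F v) else 0.

(** The second phase does not undo the first: the lower edge [e3] of the new contraction is
    negative. The positive cocontraction [k] disappears and none is created. *)
Lemma c2_weight A pi i k e1 e2 e3 e4 g i1 i2 d1 d2 :
  preflow A pi -> no_ctr_redex A pi -> pi e4 ->
  c2_redex A i k e1 e2 e3 e4 g i1 i2 d1 d2 ->
  let B := c2_flow A i k e1 e2 e3 e4 g i1 i2 d1 d2 in
  let pi' x := if x \in [:: d1; d2] then pi e3 else pi x in
  no_ctr_redex B pi' /\
  \sum_(v <- fV B) coctr_weight B pi' v < \sum_(v <- fV A) coctr_weight A pi v.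
Proof.
move=> pf nr pe redex B pi'.
have [sk si] := c2_old_stars pf redex.
have [sg [s1 [s2 kept]]] := c2_stars pf redex.
have pf' := c2_preflow pf redex.
have [iV [li [kV [lk [[e3E [e4E [e34 _]]] [_ [_ uE]]]]]]] := redex.
have old x : x \in fE A -> (x \in [:: d1; d2]) = false.
  move: uE; rewrite /= !inE !negb_or -!andbA => /and4P[_ d1E d2E _] xE.
  by have [a b] := (mem_neq xE d1E, mem_neq xE d2E); eqs.
have pe3 : ~~ pi e3.
  have := @signs_at _ _ pf i e3 e4 iV; rewrite li pe; case: si => _ u_ l_.
  rewrite !mem_cat !(perm_mem l_) !inE !eqxx !orbT => /(_ isT isT e34).
  by case: (pi e3).
have cV v : v \in fV B -> v \in [:: g; i1; i2] \/ v \in fV A /\ v \notin [:: i; k].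
  by rewrite -[fV B]/([:: g; i1; i2] ++ _) mem_cat mem_filter => /orP[|/andP[]]; auto.
split.
  move=> x xE px /kupP[v ux lv].
  have [] := cV v (preflow_up pf' xE ux).
    rewrite !inE => /or3P[]/eqP E; rewrite {v}E in ux lv.
    - case: sg => _ _ l_; have := perm_mem l_ x; rewrite mem_lower xE ux eqxx inE => /esym/eqP E.
      by move: px; rewrite E /pi' old // (negbTE pe3).
    - by case: s1 lv => ->.
    - by case: s2 lv => ->.
  case=> vV vo; have [lv' _ lo_v] := kept v vV vo.
  have : x \in lower A v by rewrite -lo_v mem_lower xE ux eqxx.
  rewrite mem_lower => /andP[xA /eqP ux'].
  rewrite /pi' old // in px.
  have kA : kup A x = Some Ctr by rewrite /kup ux' -lv lv'.
  have [n1 n2] := nr x xA px kA.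
  (* If the lower endpoint of [x] is new, its label is [Ctr] or [Int], neither of which is forbidden
     below a contraction; an old endpoint keeps its label. *)
  suff same kd : klo B x = Some kd -> kd != Ctr -> kd != Int -> klo A x = Some kd.
    by split=> /same /(_ isT isT).
  move=> /kloP[w lx <-] wC wI; have := cV w (preflow_lo pf' xE lx); case.
    by rewrite !inE => /or3P[]/eqP E; rewrite E in wC wI;
      [case: sg wC => ->|case: s1 wI => ->|case: s2 wI => ->].
  case=> wV wo; have [-> up_w _] := kept w wV wo.
  have : x \in upper A w by rewrite -up_w mem_upper xE lx eqxx.
  by rewrite mem_upper /klo => /andP[_ /eqP->].
have ik : uniq [:: i; k] by rewrite /= inE andbT; apply/eqP=> E; rewrite E lk in li.
have sub : {subset [:: i; k] <= fV A} by move=> x; rewrite !inE => /orP[]/eqP->.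
have key : {in fV A, forall v, v \notin [:: i; k] -> coctr_weight B pi' v = coctr_weight A pi v}.
  move=> v vV vo; rewrite /coctr_weight; have [-> -> _] := kept v vV vo; case: ifP => // _.
  apply: eq_in_count => x; rewrite mem_upper => /andP[xE _]; rewrite /pi' old //.
have wg : coctr_weight B pi' g = 0 by rewrite /coctr_weight; case: sg => ->.
have w1 : coctr_weight B pi' i1 = 0 by rewrite /coctr_weight; case: s1 => ->.
have w2 : coctr_weight B pi' i2 = 0 by rewrite /coctr_weight; case: s2 => ->.
have wi : coctr_weight A pi i = 0 by rewrite /coctr_weight li.
have wk : coctr_weight A pi k = 1.
  by rewrite /coctr_weight lk; case: sk => _ u_ _; rewrite (permP u_) /= pe.
have := sum_replace [:: g; i1; i2] (pf_uniqV pf) ik sub key.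
rewrite -[_ ++ _]/(fV B) !big_cons !big_nil wg w1 w2 wi wk.
by rewrite !addn0 !add0n addn1 => <-.
Qed.

Lemma reduce_interactions A pi h : preflow A pi -> ranked A h -> no_ctr_redex A pi ->
  exists B pi' h', [/\ c_star A B, preflow B pi', ranked B h', no_ctr_redex B pi' & no_int_redex B pi'].
Proof.
have [m] := ubnP (\sum_(v <- fV A) coctr_weight A pi v).
elim: m A pi h => // m IH A pi h lt pf rk nr.
pose redex e := pi e && (kup A e == Some Int) && (klo A e == Some Coctr).
have [/hasP[e eE /andP[/andP[pe /eqP/kupP[i ue li]] /eqP/kloP[k le lk]]]|/hasPn none] :=
  boolP (has redex (fE A)); last first.
  exists A, pi, h; split=> //; first exact: cs_refl.
  by move=> e eE pe ku kl; have := none e eE; rewrite /redex pe ku kl.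
have [e1 [e2 [e3 [g [i1 [i2 [d1 [d2 red]]]]]]]] := c2_redex_exists pf eE ue li le lk.
have [nr' lt'] := c2_weight pf nr pe red; have [h' rk'] := c2_ranked pf rk red.
have [C [pi'' [h'' [st' ? ? ? ?]]]] := IH _ _ _ (leq_trans lt' lt) (c2_preflow pf red) rk' nr'.
by exists C, pi'', h''; split=> //; apply: cs_step st'; apply: c2_stepI red.
Qed.

Theorem theorem4p24 :
  forall A : flow, atomic_flow A ->
  exists B : flow, atomic_flow B /\ c_star A B /\
    (forall v s, aicycle B v s -> fragile B v s).
Proof.
move=> A /atomic_flow_ranked[pi [h [pf rk]]].
have [B [pi1 [h1 [st1 pf1 rk1 nr1]]]] := reduce_contractions pf rk.
have [C [pi2 [h2 [st2 pf2 rk2 nr3 nr4]]]] := reduce_interactions pf1 rk1 nr1.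
exists C; split; first exact: ranked_atomic_flow pf2 rk2.
split; first exact: c_star_trans st1 st2.
move=> v s cy; split=> //.
have [s0 sE nx pv] := aicycle_closed pf2 cy.
exact (closed_simple pf2 rk2 nr3 nr4 s0 sE nx pv).
Qed.
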